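(* Let $G\leq \operatorname{Homeo}(\mathfrak{C})$ be finitely generated, simple and vigorous, and let $n\geq 2$ be an integer. Then there exist $\sigma,\zeta\in G$ such that $\sigma$ has finite order, $\zeta$ has order exactly $n$, and $\langle \sigma,\zeta\rangle = G$.
   Context: $\mathfrak{C}$ denotes a Cantor space (a space homeomorphic to $\{0,1\}^\omega$). Groups of homeomorphisms act on the right, and products are composed left to right. $K_{\mathfrak{C}}$ denotes the set of non-empty proper clopen subsets of $\mathfrak{C}$. For $\gamma\in\operatorname{Homeo}(\mathfrak{C})$, $\operatorname{supp}(\gamma)=\{p\in\mathfrak{C}: p\gamma\neq p\}$. A subset $S\subseteq \operatorname{Homeo}(\mathfrak{C})$ is vigorous if for all clopen $A,B,C\subseteq\mathfrak{C}$ with $B,C$ non-empty proper subsets of $A$ there is $\gamma\in S$ with $\operatorname{supp}(\gamma)\subseteq A$ and $B\gamma\subseteq C$. *)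

(* Defs.v *)
(* The Cantor space is the library's
   [cantor_space] = product topology on nat -> bool. *)
From HB Require Import structures.
From mathcomp Require Import all_boot all_order all_algebra.
From mathcomp Require Import all_classical all_reals all_analysis.
Set Implicit Arguments. Unset Strict Implicit. Unset Printing Implicit Defensive.
Local Open Scope classical_set_scope.

Notation CS := cantor_space.

Definition is_homeo (f : CS -> CS) : Prop :=
  exists g : CS -> CS,
    [/\ cancel f g, cancel g f, continuous f & continuous g].

Definition homeo_subgroup (G : set (CS -> CS)) : Prop :=
  [/\ (forall f, G f -> is_homeo f),
      G id,
      (forall f g, G f -> G g -> G (g \o f)) &
      (forall f g, G f -> cancel f g -> cancel g f -> G g)].

Definition gen (S : set (CS -> CS)) : set (CS -> CS) :=
  [set f | forall H, homeo_subgroup H -> S `<=` H -> H f].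

Definition finitely_generated (G : set (CS -> CS)) : Prop :=
  exists S : set (CS -> CS), [/\ finite_set S, S `<=` G & gen S = G].

Definition normal_subgroup (N G : set (CS -> CS)) : Prop :=
  [/\ homeo_subgroup N, N `<=` G &
      forall g g' h, G g -> cancel g g' -> cancel g' g -> N h ->
        N (g \o h \o g')].

Definition simple_group (G : set (CS -> CS)) : Prop :=
  G <> [set id] /\
  forall N, normal_subgroup N G -> N = [set id] \/ N = G.

Definition supp (g : CS -> CS) : set CS := [set p | g p <> p].

Definition vigorous (S : set (CS -> CS)) : Prop :=
  forall A B C : set CS, clopen A -> clopen B -> clopen C ->
    B !=set0 -> B `<` A -> C !=set0 -> C `<` A ->
    exists2 g, S g & supp g `<=` A /\ g @` B `<=` C.

Definition finite_order (f : CS -> CS) : Prop :=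
  exists2 k : nat, (0 < k)%N & forall x, iter k f x = x.

Definition has_order (f : CS -> CS) (n : nat) : Prop :=
  [/\ (0 < n)%N, (forall x, iter n f x = x) &
      forall k : nat, (0 < k)%N -> (k < n)%N -> exists x, iter k f x <> x].

(* Main.v *)
Require Import Defs.
From HB Require Import structures.
From mathcomp Require Import all_boot all_order all_algebra.
From mathcomp Require Import all_classical all_reals all_analysis.
From mathcomp Require Import zify.
Set Implicit Arguments. Unset Strict Implicit. Unset Printing Implicit Defensive.
Local Open Scope classical_set_scope.

(* Vigour lets one realize in [G] any injective map that is locally given by [G],
   on any proper clopen set with proper image ([extend]).  Two consequences of
   simplicity follow: transport along an embedding [psi] that is locally in [G]
   maps [G] into [G] ([tr_G]), and [G] contains all commutators of its full group
   ([full_comm]).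

   As [G] is simple, it is generated by the commutators of its elements of order
   dividing [n], hence by finitely many [[a_i, b_i]].  For a large [N] one builds an
   [f] in the full group of order dividing [N (N + 1)] and a clopen [B] such that the
   levels [f^i B] are disjoint for [i < N] and cover the space for [i <= N], with
   [sigma = f^2] in [G].  An embedding [psi] squeezes the space into
   levels 0 to 3, with image containing levels 0 to 2, and [zeta] is the product of
   the transports of the [a_i], [b_i], shifted by powers of [sigma] whose exponents
   form a Sidon set.  Commutators of suitable [sigma]-conjugates of [zeta] then
   isolate the transport of each [[a_i, b_i]], so the generated group contains a copy
   of [G] acting on the image of [psi].  The [sigma]-translates of this image form
   overlapping chains that cover the space, which yields all of [G]. *)

(** * Clopen subsets of the Cantor space *)

Lemma clopenN (A : set CS) : clopen A -> clopen (~` A).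
Proof. exact: (clopenC A). Qed.

Lemma clopenD (A B : set CS) : clopen A -> clopen B -> clopen (A `\` B).
Proof. by move=> cA cB; rewrite setDE; apply: clopenI => //; apply: clopenN. Qed.

Lemma clopen_coord (i : nat) (b : bool) : clopen [set x : CS | x i = b].
Proof.
have -> : [set x : CS | x i = b] = (@proj nat (fun=> bool) i) @^-1` [set b] by [].
apply: preimage_clopen; last exact: proj_continuous.
by split; [exact: discrete_open|exact: discrete_closed].
Qed.

(** The Cantor space is perfect, so [E] has two distinct points, and a coordinate where they differ
    cuts [E]. *)
Lemma clopen_split (E : set CS) : clopen E -> E !=set0 ->
  exists F : set CS, [/\ clopen F, F `<=` E, F !=set0 & (E `\` F) !=set0].
Proof.
move=> cE E0; have /perfectTP_ex/(_ E cE.1 E0) [x [y [Ex Ey xy]]] := cantor_perfect.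
have [i xyi] : exists i, x i <> y i.
  by apply/existsNP => xyE; case/eqP: xy; apply/funext.
exists (E `&` [set z : CS | z i = x i]); split.
- exact: clopenI (clopen_coord _ _).
- by move=> z [].
- by exists x.
- by exists y; split => // -[_ /= /esym].
Qed.

(** The sequences starting with [k] times [true] and then [false]: a concrete infinite supply of
    disjoint non-empty clopen sets. *)
Definition spike (k : nat) : set CS :=
  [set x | x k = false /\ forall j, (j < k)%N -> x j = true].

Lemma clopen_spike k : clopen (spike k).
Proof.
have -> : spike k = [set x : CS | x k = false] `&`
    [set x | forall j, (j < k)%N -> x j = true] by [].
apply: clopenI; first exact: clopen_coord.
elim: k => [|k IH].
  suff -> : [set x : CS | forall j, (j < 0)%N -> x j = true] = setT by exact: clopenT.
  by apply/seteqP; split.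
suff -> : [set x : CS | forall j, (j < k.+1)%N -> x j = true] =
    [set x : CS | forall j, (j < k)%N -> x j = true] `&` [set x : CS | x k = true].
  exact: clopenI (clopen_coord _ _).
apply/seteqP; split=> x /=.
  by move=> H; split; [move=> j jk; apply: H; apply: ltnW|exact: H].
by move=> [H xk] j; rewrite ltnS leq_eqVlt => /predU1P[->//|/H].
Qed.

Lemma spike_neq0 k : spike k !=set0.
Proof. by exists (fun j => (j < k)%N); split => /=; [rewrite ltnn|]. Qed.

Lemma spike_disj k l x : spike k x -> spike l x -> k = l.
Proof.
move=> [xk xk'] [xl xl']; case: (ltngtP k l) => // [/xl'|/xk'].
  by rewrite xk.
by rewrite xl.
Qed.

Lemma spike_avoid (x : CS) : exists k, forall l, (k <= l)%N -> ~ spike l x.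
Proof.
case: (pselect (exists k, spike k x)) => [[k xk]|xn].
  by exists k.+1 => l kl /(spike_disj xk) klE; rewrite klE ltnn in kl.
by exists 0%N => l _ xl; apply: xn; exists l.
Qed.

(** Each point lies in at most one spike, so all spikes far enough out miss the three points. *)
Lemma avoid3 (x y z : CS) : exists F O : set CS,
  [/\ clopen F, F !=set0, clopen O, O !=set0 & F `&` O = set0] /\
  [/\ ~ (F `|` O) x, ~ (F `|` O) y & ~ (F `|` O) z].
Proof.
have [i ix] := spike_avoid x; have [j jy] := spike_avoid y.
have [k kz] := spike_avoid z.
set m := (i + j + k)%N.
have [im jm km] : [/\ (i <= m)%N, (j <= m)%N & (k <= m)%N].
  by rewrite /m -addnA leq_addr addnCA leq_addr addnA leq_addl.
exists (spike m), (spike m.+1); split; first split; do ?exact: clopen_spike;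
  do ?exact: spike_neq0.
  rewrite -subset0 => w [/spike_disj H /H mE].
  by have := ltnn m; rewrite {2}mE ltnSn.
have S n : (n <= m -> n <= m.+1)%N by move/leqW.
by split => -[]; [apply: ix|apply: ix; apply: S|apply: jy|apply: jy; apply: S|
  apply: kz|apply: kz; apply: S].
Qed.

(** Compactness as an induction principle: the good neighbourhoods have a finite subcover, whose
    union is built one set at a time. *)
Lemma clopen_cover_ind (P : set CS -> Prop) :
  (forall x, exists2 V, clopen V /\ V x & P V) -> P set0 ->
  (forall V W, clopen V -> clopen W -> P V -> P W -> P (V `|` W)) -> P setT.
Proof.
move=> Ploc P0 PU.
have /choice[V VP] : forall x, exists V, [/\ clopen V, V x & P V].
  by move=> x; have [V [cV Vx] PV] := Ploc x; exists V.
have := cantor_space_compact; rewrite compact_cover.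
move=> /(_ _ setT V); case=> [x _|x _|D _ cov].
- by have [[]] := VP x.
- by exists x => //; have [] := VP x.
have VS (s : seq CS) :
    clopen (\big[setU/set0]_(i <- s) V i) /\ P (\big[setU/set0]_(i <- s) V i).
  elim: s => [|x s [cs Ps]]; first by rewrite big_nil; split => //; exact: clopen0.
  rewrite big_cons; have [cV _ PV] := VP x.
  by split; [exact: clopenU|exact: PU].
by move: cov; rewrite /cover bigcup_fset subTset => <-; exact: (VS _).2.
Qed.

(** * Inverses, commutators, supports and iterates *)

(** A total inverse, so that group operations apply to bare functions; off the range of [f] the
    default value is the point itself. *)
Definition hinv (f : CS -> CS) (q : CS) : CS := xget q [set p | f p = q].

Lemma injK f : injective f -> cancel f (hinv f).
Proof. by move=> fI p; apply: fI; apply: (@xgetPex _ (f p) [set r | f r = f p]); exists p. Qed.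

Lemma cancel_hinv f g : cancel f g -> cancel g f -> hinv f = g.
Proof.
move=> fK gK; apply/funext => q; rewrite -[in LHS](gK q).
exact: injK (can_inj fK) _.
Qed.

Definition comm (f g : CS -> CS) : CS -> CS := f \o g \o hinv f \o hinv g.

Definition fixes (f : CS -> CS) (A : set CS) := forall x, A x -> f x = x.

Lemma fixesV f A : injective f -> fixes f A -> fixes (hinv f) A.
Proof. by move=> fI fA x Ax; rewrite -[x in LHS](fA _ Ax) injK. Qed.

Lemma fixes_stable f A x : injective f -> fixes f (~` A) -> A x -> A (f x).
Proof.
move=> fI fA Ax; apply: contrapT => nA.
by have /fI fx := fA _ nA; rewrite fx in nA.
Qed.

Lemma disjoint_commute f r A B x : injective f -> injective r ->
  fixes f (~` A) -> fixes r (~` B) -> (forall y, A y -> ~ B y) ->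
  f (r x) = r (f x).
Proof.
move=> fI rI fA rB AB; case: (pselect (A x)) => Ax.
  by have /AB Bfx := fixes_stable fI fA Ax; rewrite (rB x) ?(rB (f x)) //; exact: AB.
rewrite (fA x) //; case: (pselect (B x)) => Bx; last by rewrite rB // fA.
by rewrite fA // => /AB; apply; exact: (fixes_stable rI rB Bx).
Qed.

Lemma iter_commute (f r : CS -> CS) k x : (forall y, f (r y) = r (f y)) ->
  iter k (f \o r) x = iter k f (iter k r x).
Proof.
move=> fr; have frk y j : iter j f (r y) = r (iter j f y).
  by elim: j => //= j ->.
by elim: k => //= k ->; rewrite -frk.
Qed.

Lemma iter_can (f g : CS -> CS) k : cancel f g -> cancel (iter k f) (iter k g).
Proof. by move=> fK; elim: k => // k IH x; rewrite iterSr /= fK IH. Qed.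

Lemma iter_mul_fix (f : CS -> CS) k m x : iter m f x = x -> iter (k * m) f x = x.
Proof. by move=> fx; elim: k => // k IH; rewrite mulSn iterD IH. Qed.

(** * Groups of homeomorphisms and generation *)

Section Subgroups.
Variables (G : set (CS -> CS)) (hG : homeo_subgroup G).

Lemma sub1 : G id. Proof. by case: hG. Qed.

Lemma subM f g : G f -> G g -> G (f \o g).
Proof. by case: hG => _ _ H _ Gf Gg; apply: H. Qed.

Lemma subVK f : G f -> cancel f (hinv f) /\ cancel (hinv f) f.
Proof.
case: hG => H _ _ _ /H [g [fK gK _ _]].
by rewrite (cancel_hinv fK gK).
Qed.

Lemma subK f : G f -> cancel f (hinv f). Proof. by move/subVK => []. Qed.

Lemma subKV f : G f -> cancel (hinv f) f. Proof. by move/subVK => []. Qed.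

Lemma subV f : G f -> G (hinv f).
Proof. by move=> Gf; case: hG => _ _ _; apply; [exact: Gf|exact: subK|exact: subKV]. Qed.

Lemma sub_inj f : G f -> injective f. Proof. by move/subK/can_inj. Qed.

Lemma sub_cont f : G f -> continuous f.
Proof. by case: hG => H _ _ _ /H [g []]. Qed.

Lemma subVV f : G f -> hinv (hinv f) = f.
Proof. by move=> Gf; apply: cancel_hinv; [exact: subKV|exact: subK]. Qed.

Lemma sub_comm f g : G f -> G g -> G (comm f g).
Proof. by move=> Gf Gg; do !apply: subM => //; apply: subV. Qed.

Lemma sub_iter f k : G f -> G (iter k f).
Proof. by move=> Gf; elim: k => [|k IH]; [exact: sub1|exact: subM Gf IH]. Qed.

Lemma clopen_preim f A : G f -> clopen A -> clopen (f @^-1` A).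
Proof. by move=> /sub_cont fc cA; exact: preimage_clopen. Qed.

Lemma imgE f A : G f -> f @` A = hinv f @^-1` A.
Proof.
move=> Gf; apply/seteqP; split => [_ [x Ax <-]|x Ax] /=; first by rewrite subK.
by exists (hinv f x) => //; rewrite subKV.
Qed.

Lemma clopen_img f A : G f -> clopen A -> clopen (f @` A).
Proof. by move=> Gf cA; rewrite imgE //; apply: clopen_preim => //; apply: subV. Qed.

(** This serves as an induction principle: a property holds on a generated group once the elements
    having it form a subgroup containing the generators. *)
Lemma homeo_subgroup_sub (P : set (CS -> CS)) : P `<=` G -> P id ->
  (forall f g, P f -> P g -> P (f \o g)) -> (forall f, P f -> P (hinv f)) ->
  homeo_subgroup P.
Proof.
move=> PG P1 PM PV; split => //.
- by move=> f /PG; case: hG => H _ _ _ /H.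
- by move=> f g Pf Pg; apply: PM.
- by move=> f g Pf fK gK; rewrite -(cancel_hinv fK gK); apply: PV.
Qed.

Lemma gen_sub S : S `<=` G -> gen S `<=` G.
Proof. by move=> SG f; apply. Qed.

Lemma gen_subgroup S : S `<=` G -> homeo_subgroup (gen S).
Proof.
move=> SG; apply: homeo_subgroup_sub; first exact: gen_sub.
- by move=> H hH _; case: hH.
- by move=> f g fS gS H hH SH; case: (hH) => _ _ + _; apply; [exact: gS|exact: fS].
- move=> f fS H hH SH; case: (hH) => _ _ _; apply; first exact: (fS H).
    by apply: subK; apply: gen_sub fS.
  by apply: subKV; apply: gen_sub fS.
Qed.

Lemma gen_inc S : S `<=` gen S.
Proof. by move=> f Sf H _; apply. Qed.

Definition conj_by (g h : CS -> CS) := g \o h \o hinv g.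

Lemma conjM g h k : G g -> conj_by g (h \o k) = conj_by g h \o conj_by g k.
Proof. by move=> Gg; apply/funext => x; rewrite /conj_by /= subK. Qed.

Lemma conjV g h : G g -> G h -> conj_by g (hinv h) = hinv (conj_by g h).
Proof.
move=> Gg Gh; apply/esym/cancel_hinv => x; rewrite /conj_by /=.
  by rewrite subK // subK // subKV.
by rewrite subK // subKV // subKV.
Qed.

Lemma sub_conj g h : G g -> G h -> G (conj_by g h).
Proof. by move=> Gg Gh; do 2?apply: subM => //; apply: subV. Qed.

Hypothesis sG : simple_group G.

(** The group generated by a conjugation-invariant set is normal, and a non-trivial element in it
    rules out the trivial alternative of simplicity. *)
Lemma simple_gen S : S `<=` G ->
  (forall g s, G g -> S s -> S (conj_by g s)) -> (exists2 s, S s & s <> id) ->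
  gen S = G.
Proof.
move=> SG SJ [s Ss s1].
have hS := gen_subgroup SG; have gG := gen_sub SG.
have nS : normal_subgroup (gen S) G.
  split => // g g' h Gg gK g'K Sh.
  rewrite -(cancel_hinv gK g'K) -/(conj_by g h).
  (* The elements whose conjugate by [g] stays in [gen S] form a subgroup containing [S], hence
     include all of [gen S]. *)
  pose N := [set h | G h /\ gen S (conj_by g h)].
  suff /(Sh N) [] : homeo_subgroup N.
  - by move=> u Su; split; [exact: SG|apply: gen_inc; exact: SJ].
  - by [].
  apply: homeo_subgroup_sub.
  - by move=> ? [].
  - split; first exact: sub1.
    rewrite (_ : conj_by g id = id) ?sub1 //; first by case: hS.
    by apply/funext => x; rewrite /conj_by /= subKV.
  - move=> u v [Gu Su] [Gv Sv]; split; first exact: subM.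
    by rewrite conjM //; case: hS => _ _ + _; apply.
  - move=> u [Gu Su]; split; first exact: subV.
    rewrite conjV //; case: hS => _ _ _; apply; first exact: Su.
      by apply: subK; exact: sub_conj.
    by apply: subKV; exact: sub_conj.
case: sG => _ /(_ _ nS) [] // E1; case: s1.
by have := gen_inc Ss; rewrite E1.
Qed.

End Subgroups.

(** * Dynamics of a simple vigorous group *)

Section Vigorous.
Variables (G : set (CS -> CS)) (hG : homeo_subgroup G).
Hypotheses (sG : simple_group G) (vG : vigorous G).

Let gK := subK hG.
Let gVK := subKV hG.

Lemma vig A B C : clopen A -> clopen B -> clopen C ->
  B `<=` A -> B !=set0 -> A `\` B !=set0 ->
  C `<=` A -> C !=set0 -> A `\` C !=set0 ->
  exists g, [/\ G g, fixes g (~` A) & forall x, B x -> C (g x)].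
Proof.
move=> cA cB cC BA B0 [a [Aa Ba]] CA C0 [b [Ab Cb]].
have [||g Gg [sg gB]] := vG cA cB cC B0 _ C0.
- by split=> // /(_ _ Aa).
- by split=> // /(_ _ Ab).
exists g; split=> // [x Ax|x Bx]; last by apply: gB; exists x.
by apply: contrapT => gx; apply: Ax; exact: sg.
Qed.

Lemma vigT B C : clopen B -> clopen C -> B !=set0 -> ~` B !=set0 ->
  C !=set0 -> ~` C !=set0 -> exists2 g, G g & forall x, B x -> C (g x).
Proof.
move=> cB cC B0 [b nb] C0 [c nc].
have [//| | //| |g [Gg _ gB]] := @vig setT B C clopenT cB cC _ B0 _ _ C0 _.
- by exists b.
- by exists c.
- by exists g.
Qed.

(** * Elements that fix a non-empty clopen set pointwise *)

Definition small (g : CS -> CS) :=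
  exists W : set CS, [/\ clopen W, W !=set0 & fixes g W].

Lemma smallV g : G g -> small g -> small (hinv g).
Proof.
move=> Gg [W [cW W0 gW]]; exists W; split => //.
exact: fixesV (sub_inj hG Gg) gW.
Qed.

Lemma small_conj g h : G g -> small h -> small (conj_by g h).
Proof.
move=> Gg [W [cO [x Ox] hW]]; exists (g @` W); split.
- exact: (clopen_img hG Gg).
- by exists (g x); exists x.
- by move=> _ [y Oy <-]; rewrite /conj_by /= gK // hW.
Qed.

(** Small elements form a conjugation-invariant set, and vigour inside the complement of [spike 2]
    yields a non-trivial one, so by simplicity they generate [G]. *)
Lemma small_gen N : homeo_subgroup N ->
  (forall g, G g -> small g -> N g) -> G `<=` N.
Proof.
move=> hN sN.
rewrite -(simple_gen hG sG (S := [set g | G g /\ small g])).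
- by move=> f; apply => // g [Gg]; apply: sN.
- by move=> g [].
- by move=> g s Gg [Gs ss]; split; [exact: sub_conj|exact: small_conj].
have sp k l : k <> l -> spike k `<=` ~` spike l.
  by move=> kl x xk xl; apply: kl; exact: spike_disj xk xl.
have [x0 x0P] := spike_neq0 0; have [x1 x1P] := spike_neq0 1.
have [| | | | | | |||g [Gg g2 g01]] := @vig (~` spike 2) (spike 0) (spike 1).
- exact/clopenN/clopen_spike.
- exact: clopen_spike.
- exact: clopen_spike.
- exact: sp.
- by exists x0.
- by exists x1; split; [exact: sp x1P|exact: sp x1P].
- exact: sp.
- by exists x1.
- by exists x0; split; [exact: sp x0P|exact: sp x0P].
exists g; last by move=> gE; have := g01 _ x0P; rewrite gE => /(spike_disj x0P).
split=> //; exists (spike 2); split; [exact: clopen_spike|exact: spike_neq0|].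
by move=> x x2; apply: g2; apply.
Qed.

(* Conjugating [g] by an element that pushes the rest of the support of [g]
   into [F] does not change [g] on [A]. *)
Lemma small_localize g A F : G g -> small g -> clopen A -> clopen F ->
  F !=set0 -> F `&` A = set0 -> F `&` g @` A = set0 ->
  exists g', [/\ G g', fixes g' (~` (A `|` g @` A `|` F)) &
    forall x, A x -> g' x = g x].
Proof.
move=> Gg [W [cO [w Ww] gW]] cA cF [p Fp] FA FgA.
have nFA x : F x -> ~ A x by move=> Fx Ax; have : (F `&` A) x by []; rewrite FA.
have nFgA x : F x -> ~ (g @` A) x.
  by move=> Fx Ax; have : (F `&` g @` A) x by []; rewrite FgA.
have gWi x : W (g x) -> W x.
  by move=> Ogx; have := gW _ Ogx => /(sub_inj hG Gg) xE; rewrite -xE.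
(* Dropping the points of [A] already fixed in [W] makes [D] disjoint from [W]; then [W] is the
   spare room needed to apply vigour in the complement of [D]. *)
pose A' := A `\` W; pose D := A' `|` g @` A'.
have cA' : clopen A' by exact: clopenD.
have cD : clopen D by apply: clopenU => //; exact: (clopen_img hG Gg).
have DO x : D x -> ~ W x by case=> [[]//|[y [_ yO] <-] /gWi].
have DA : D `<=` A `|` g @` A.
  by move=> x [[Ax _]|[y [Ay _] <-]]; [left|right; exists y].
have FD : F `<=` ~` D by move=> x Fx /DA [/(nFA _ Fx)|/(nFgA _ Fx)].
pose Z := ~` (W `|` D).
have cZ : clopen Z by apply/clopenN => //; exact: clopenU.
have gAA x : A x -> (A `|` g @` A) (g x) by move=> Ax; right; exists x.
(* If [Z] is empty, or if [F] exhausts the complement of [D], then [g] itself meets the support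
   condition. *)
case: (pselect (Z !=set0)) => [Z0|Z0]; last first.
  exists g; split=> // x xN; apply: contrapT => gx; apply: xN; left; apply: DA.
  apply: contrapT => xD; apply: Z0; exists x; case => // /gW; exact: gx.
case: (pselect ((~` D) `\` F !=set0)) => [DF|DF]; last first.
  exists g; split=> // x xN; exfalso; apply: xN.
  case: (pselect (D x)) => [/DA|xD]; first by left.
  by right; apply: contrapT => xF; apply: DF; exists x.
have [|||h [Gh hD hZ]] := @vig (~` D) Z F (clopenN cD) cZ cF _ Z0 _ FD _ DF.
- by move=> x; apply: contra_not; right.
- by exists w; split; [move=> /DO; apply|apply; left].
- by exists p.
have hD' x : D x -> h x = x by move=> Dx; apply: hD; apply.
have hVD x : D x -> hinv h x = x by move=> Dx; exact: (fixesV (sub_inj hG Gh) hD').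
exists (conj_by h g); split; first exact: sub_conj.
- move=> x xN; rewrite /conj_by /=.
  have xD : ~ D x by move=> /DA xD; apply: xN; left.
  case: (pselect (W (hinv h x))) => [/gW ->|hW]; first exact: (gVK Gh).
  exfalso; apply: xN; right; rewrite -(gVK Gh x); apply: hZ => -[] //.
  by move=> hx; have := hD' _ hx; rewrite gVK // => xE; apply: xD; rewrite xE.
- move=> x Ax; rewrite /conj_by /=.
  case: (pselect (W x)) => Ox; last first.
    have A'x : A' x by [].
    rewrite hVD; last by left.
    by rewrite hD' //; right; exists x.
  rewrite [g x]gW //; suff yW : W (hinv h x) by rewrite gW // gVK.
  apply: contrapT => yW; case: (pselect (D (hinv h x))) => yD.
    have := hD' _ yD; rewrite gVK // => xE.
    by apply: (DO (hinv h x)) => //; rewrite -xE.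
  apply: (nFA x) => //; rewrite -(gVK Gh x).
  by apply: hZ => -[].
Qed.

Definition loc_small (g : CS -> CS) := forall p, exists V g',
  [/\ clopen V, V p, G g', small g' & forall x, V x -> g' x = g x].

(** Elements that are locally small form a subgroup containing the small ones. For a product, both
    factors are first localized so that their product still fixes a clopen set. *)
Lemma G_loc_small g : G g -> loc_small g.
Proof.
move=> Gg; suff [] : [set f | G f /\ loc_small f] g by [].
apply: small_gen Gg; last first.
  move=> f Gf sf; split=> // p; exists setT, f; split => //; exact: clopenT.
apply: (homeo_subgroup_sub hG).
- by move=> f [].
- split; first exact: sub1.
  move=> p; exists setT, id; split => //; first exact: clopenT.
    exact: sub1.
  by exists setT; split => //; [exact: clopenT|exists p].
- move=> g2 g1 [Gg2 l2] [Gg1 l1]; split; first exact: subM.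
  move=> p; have [V1 [f1 [cV1 V1p Gf1 sf1 f1E]]] := l1 p.
  have [V2 [f2 [cV2 V2p Gf2 sf2 f2E]]] := l2 (g1 p).
  (* [F] absorbs the unwanted support of both localized factors, while [W] stays outside their
     supports and so witnesses smallness of the product. *)
  have [F [W [[cF F0 cW W0 FW] [np n1p n2p]]]] := avoid3 p (g1 p) (g2 (g1 p)).
  have cFW : clopen (F `|` W) by exact: clopenU.
  pose A2 := V2 `&` (~` (F `|` W) `&` g2 @^-1` (~` (F `|` W))).
  have cA2 : clopen A2.
    apply: clopenI => //; apply: clopenI; first exact: clopenN.
    by apply: (clopen_preim hG) => //; exact: clopenN.
  pose A1 := V1 `&` (~` (F `|` W) `&` g1 @^-1` A2).
  have cA1 : clopen A1.
    apply: clopenI => //; apply: clopenI; first exact: clopenN.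
    exact: (clopen_preim hG).
  have [||h1 [Gh1 h1f h1E]] := @small_localize f1 A1 F Gf1 sf1 cA1 cF F0.
  + by rewrite -subset0 => x [Fx [_ [+ _]]]; apply; left.
  + rewrite -subset0 => y [Fy [x [V1x [_ [_ [nF _]]]] xy]].
    by apply: nF; left; rewrite -f1E // xy.
  have [||h2 [Gh2 h2f h2E]] := @small_localize f2 A2 F Gf2 sf2 cA2 cF F0.
  + by rewrite -subset0 => x [Fx [_ [+ _]]]; apply; left.
  + rewrite -subset0 => y [Fy [x [V2x [_ nF]] xy]].
    by apply: nF; left; rewrite -f2E // xy.
  exists A1, (h2 \o h1); split => //.
  + exact: subM.
  + exists W; split => // x Wx /=; have nF : ~ F x.
      by move=> Fx; have : (F `&` W) x by []; rewrite FW.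
    rewrite h1f ?h2f // => -[[[_ [+ _]]|]|//].
    * by apply; right.
    * by move=> [y [V2y [_ +]] yE]; apply; rewrite -f2E // yE; right.
    * by apply; right.
    * move=> [y [V1y [_ [_ [+ _]]]] yE]; apply; rewrite -f1E // yE; right.
      exact: Wx.
  + move=> x A1x /=; rewrite h1E //; case: A1x => V1x [_ A2x].
    by rewrite f1E // h2E // f2E //; case: A2x.
- move=> f [Gf lf]; split; first exact: subV.
  move=> p; have [V [f' [cV Vp Gf' sf' f'E]]] := lf (hinv f p).
  exists (hinv f @^-1` V), (hinv f'); split => //.
  + by apply: (clopen_preim hG) => //; exact: subV.
  + exact: subV.
  + exact: smallV.
  + by move=> x Vx; rewrite -[in LHS](gVK Gf x) -f'E // gK.
Qed.

(** * Realizing maps that are locally in the group *)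

Definition loc_in (f : CS -> CS) (A : set CS) := forall p, A p ->
  exists V g, [/\ clopen V, V p, G g & forall x, V x -> f x = g x].

Lemma loc_in_sub f A B : B `<=` A -> loc_in f A -> loc_in f B.
Proof. by move=> BA lf p /BA /lf. Qed.

Lemma loc_comp f g A B : (forall x, A x -> B (g x)) -> loc_in f B -> loc_in g A ->
  loc_in (f \o g) A.
Proof.
move=> AB lf lg p Ap; have [V [k [cV Vp Gk kE]]] := lg p Ap.
have [W [l [cW Wp Gl lE]]] := lf (g p) (AB _ Ap).
exists (V `&` k @^-1` W), (l \o k); split.
- by apply: clopenI => //; apply: (clopen_preim hG).
- by split=> //=; rewrite -kE.
- exact: subM.
- by move=> x [Vx /= Wx]; rewrite kE // lE.
Qed.

Lemma G_loc g A : G g -> loc_in g A.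
Proof. by move=> Gg p _; exists setT, g; split => //; exact: clopenT. Qed.

Lemma loc_cont f : loc_in f setT -> continuous f.
Proof.
move=> lf p; have [V [g [cV Vp Gg gE]]] := lf p I.
move=> A; rewrite gE // => gA0.
have gA : nbhs p (g @^-1` A) by exact: (sub_cont hG Gg gA0).
have Vn : nbhs p V by apply: open_nbhs_nbhs; split => //; case: cV.
by apply: filterS (filterI Vn gA) => x [Vx /=]; rewrite gE.
Qed.

(** Near each point [phi] is a small element, which can be localized. Local solutions are multiplied
    along a finite cover; they do not interfere because [phi] is injective, [A] misses its image and
    each uses its own piece of [F]. *)
Lemma extend_disjoint phi A F : clopen A -> clopen F -> F !=set0 ->
  loc_in phi A -> {in A &, injective phi} ->
  (forall x, A x -> ~ A (phi x)) -> (forall x, A x -> ~ F x /\ ~ F (phi x)) ->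
  exists g, [/\ G g, fixes g (~` (A `|` phi @` A `|` F)) &
    forall x, A x -> g x = phi x].
Proof.
move=> cA cF F0 lphi iphi Aphi FA.
(* The spare room [E] is quantified inside [P], so that the union step can give each half a
   different part of it. *)
pose P V := forall B E, clopen B -> B `<=` V -> B `<=` A -> clopen E -> E !=set0 ->
  (forall x, B x -> ~ E x /\ ~ E (phi x)) ->
  exists g, [/\ G g, fixes g (~` (B `|` phi @` B `|` E)) &
    forall x, B x -> g x = phi x].
suff : P setT by move=> /(_ A F); apply.
have P0 V : V `&` A = set0 -> P V.
  move=> VA B E _ BV BA _ _ _; exists id; split => //; first exact: sub1.
  move=> x Bx; have : (V `&` A) x by split; [exact: BV|exact: BA].
  by rewrite VA.
apply: clopen_cover_ind.
- move=> p; case: (pselect (A p)) => Ap; last first.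
    exists (~` A); first by split => //; exact: clopenN.
    by apply: P0; rewrite setICl.
  have [V [g [cV Vp Gg gE]]] := lphi p Ap.
  have [U [g' [cU Up Gg' sg' g'E]]] := G_loc_small Gg p.
  exists (V `&` U); first by split => //; exact: clopenI.
  move=> B E cB BVU BA cE E0 EB.
  have gphi x : B x -> g' x = phi x.
    by move=> /BVU [Vx Ux]; rewrite g'E // gE.
  have gB : g' @` B = phi @` B.
    by apply/seteqP; split => _ [x Bx <-]; exists x; rewrite ?gphi.
  have [||h [Gh hf hE]] := @small_localize g' B E Gg' sg' cB cE E0.
  + by rewrite -subset0 => x [Ex /EB []].
  + by rewrite gB -subset0 => x [Ex [y /EB [_ nE] yx]]; apply: nE; rewrite yx.
  exists h; split => //; first by rewrite -gB.
  by move=> x Bx; rewrite hE // gphi.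
- by apply: P0; rewrite set0I.
- move=> V W cV cW PV PW B E cB BVW BA cE E0 EB.
  have [E1 [cE1 E1E E10 E20]] := clopen_split cE E0.
  have [g1 [Gg1 g1f g1E]] : exists g, [/\ G g,
      fixes g (~` ((B `&` V) `|` phi @` (B `&` V) `|` E1)) &
      forall x, (B `&` V) x -> g x = phi x].
    apply: PV => //; first exact: clopenI.
    - by move=> x [/BA].
    - by move=> x [/EB [Ex Epx] _]; split => /E1E.
  have [g2 [Gg2 g2f g2E]] : exists g, [/\ G g,
      fixes g (~` ((B `\` V) `|` phi @` (B `\` V) `|` (E `\` E1))) &
      forall x, (B `\` V) x -> g x = phi x].
    apply: PW => //; first exact: clopenD.
    - by move=> x [/BVW []].
    - by move=> x [/BA].
    - exact: clopenD.
    - by move=> x [/EB [Ex Epx] _]; split => -[].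
  exists (g1 \o g2); split; first exact: subM.
  + move=> x xN /=; rewrite g2f ?g1f // => -[[[Bx _]|[y [By _] yx]]|].
    * by apply: xN; left; left.
    * by apply: xN; left; right; exists y.
    * by move=> /E1E Ex; apply: xN; right.
    * by apply: xN; left; left.
    * by apply: xN; left; right; exists y.
    * by case=> Ex _; apply: xN; right.
  + move=> x Bx /=; have [Ex Epx] := EB _ Bx; have Ax := BA _ Bx.
    case: (pselect (V x)) => Vx.
      rewrite g2f ?g1E // => -[[[]//|[y [/BA By _] yx]]|[//]].
      by apply: (Aphi y) => //; rewrite yx.
    rewrite g2E // g1f // => -[[[/BA Apx _]|[y [By Vy] yx]]|/E1E] //.
      exact: (Aphi x).
    have yE : y = x by apply: iphi => //; rewrite inE //; exact: BA.
    by apply: Vx; rewrite -yE.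
Qed.

(** The case where [A] meets its image is reduced to the disjoint one: some [h] first moves [A] into
    a piece [D] of [Z], which the image misses, and [Z] minus [D] remains as spare room. *)
Lemma extend phi A Z : clopen A -> ~` A !=set0 -> loc_in phi A ->
  {in A &, injective phi} -> clopen Z -> Z !=set0 ->
  (forall x, A x -> ~ Z (phi x)) ->
  exists2 g, G g & forall x, A x -> g x = phi x.
Proof.
move=> cA nA lphi iphi cZ Z0 AZ.
case: (pselect (A !=set0)) => [A0|A0]; last first.
  by exists id; [exact: sub1|move=> x Ax; case: A0; exists x].
have [D [cD DZ D0 F0]] := clopen_split cZ Z0.
have [||||h [Gh _ hAD]] := @vig setT A D clopenT cA cD _ A0 _ _ D0 _.
- by [].
- by case: nA => x; exists x.
- by [].
- by case: F0 => x [_ nD]; exists x.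
have Gh' := subV hG Gh.
pose A' := hinv h @^-1` A.
have A'D x : A' x -> D x by move=> /hAD; rewrite gVK.
have [|||||||g [Gg _ gE]] := @extend_disjoint (phi \o hinv h) A' (Z `\` D).
- exact: (clopen_preim hG).
- exact: clopenD.
- exact: F0.
- by apply: (loc_comp (B := A)) => //; exact: G_loc.
- move=> x y; rewrite !inE => A'x A'y /= /iphi.
  by rewrite !inE => /(_ A'x A'y) /(sub_inj hG Gh').
- by move=> x A'x /A'D /DZ; exact: AZ.
- by move=> x A'x; split => -[Zx]; [apply; exact: A'D|move=> _; exact: (AZ _ A'x)].
exists (g \o h); first exact: subM.
by move=> x Ax /=; rewrite gE /= /A' /= ?gK.
Qed.

(** * Transport along embeddings *)

Definition embedding psi := injective psi /\ loc_in psi setT.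

(** The image of a small neighbourhood of a point outside [A] is clopen and missed by [psi] on [A],
    which is the room that [extend] asks for. *)
Lemma emb_extend psi A : embedding psi -> clopen A -> ~` A !=set0 ->
  exists2 g, G g & forall x, A x -> g x = psi x.
Proof.
move=> [ipsi lpsi] cA [p Ap].
have [V [g [cV Vp Gg gE]]] := lpsi p I.
apply: (extend (Z := g @` (V `&` ~` A))) => //.
- by exists p.
- exact: loc_in_sub lpsi.
- by move=> x y _ _; exact: ipsi.
- by apply: (clopen_img hG) => //; apply: clopenI => //; exact: clopenN.
- by exists (g p), p.
- by move=> x Ax [y [Vy Ay]]; rewrite -gE // => /ipsi yx; apply: Ay; rewrite yx.
Qed.

(** The copy of [x] acting on the range of [psi]; it replaces conjugation by [psi], which may fail
    to be onto. *)
Definition tr (psi x : CS -> CS) (q : CS) : CS :=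
  if pselect (range psi q) then psi (x (hinv psi q)) else q.

Lemma tr_in psi x p : injective psi -> tr psi x (psi p) = psi (x p).
Proof.
move=> ipsi; rewrite /tr; case: pselect => [r|nr]; first by rewrite injK.
by case: nr; exists p.
Qed.

Lemma tr_out psi x : fixes (tr psi x) (~` range psi).
Proof. by move=> q nq; rewrite /tr; case: pselect. Qed.

Lemma tr_ext (psi f g : CS -> CS) : (forall p, f (psi p) = g (psi p)) ->
  fixes f (~` range psi) -> fixes g (~` range psi) -> f = g.
Proof.
move=> fg fo go; apply/funext => q.
case: (pselect (range psi q)) => [[p _ <-]//|nq].
by rewrite fo // go.
Qed.

Lemma tr1 psi : injective psi -> tr psi id = id.
Proof.
by move=> ipsi; apply: (tr_ext (psi := psi)) => // [p|]; [rewrite tr_in|exact: tr_out].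
Qed.

Lemma trM psi x y : injective psi -> tr psi (x \o y) = tr psi x \o tr psi y.
Proof.
move=> ipsi; apply: (tr_ext (psi := psi)) => [p||] /=.
- by rewrite !tr_in.
- exact: tr_out.
- by move=> q nq /=; rewrite !tr_out.
Qed.

Lemma trV psi x : injective psi -> G x -> tr psi (hinv x) = hinv (tr psi x).
Proof.
move=> ipsi Gx.
have E1 : hinv x \o x = id by apply/funext => p /=; rewrite gK.
have E2 : x \o hinv x = id by apply/funext => p /=; rewrite gVK.
apply/esym/cancel_hinv => q.
  by have := congr1 (@^~ q) (trM (hinv x) x ipsi); rewrite E1 tr1.
by have := congr1 (@^~ q) (trM x (hinv x) ipsi); rewrite E2 tr1.
Qed.

(** Only the values of [psi] on the support of [x] matter, so any [g] agreeing with [psi] there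
    turns transport into conjugation. *)
Lemma tr_conj psi A g x : injective psi -> G g -> (forall p, A p -> g p = psi p) ->
  G x -> fixes x (~` A) -> tr psi x = conj_by g x.
Proof.
move=> ipsi Gg gE Gx xf; have gf q : ~ A (hinv g q) -> conj_by g x q = q.
  by move=> /xf qE; rewrite /conj_by /= qE gVK.
apply: (tr_ext (psi := psi)) => [p||]; last 2 first.
- exact: tr_out.
- by move=> q nq; apply: gf => Aq; apply: nq; exists (hinv g q); rewrite // -gE ?gVK.
rewrite tr_in //; case: (pselect (A p)) => Ap.
  by rewrite /conj_by /= -[in RHS]gE // gK // gE //; exact: (fixes_stable (sub_inj hG Gx) xf Ap).
rewrite gf ?xf // => Aq; apply: Ap.
suff -> : p = hinv g (psi p) by [].
by apply: ipsi; rewrite -(gE _ Aq) gVK.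
Qed.

(** Since [tr psi] is multiplicative, small elements suffice. On the support of a small element
    [psi] extends to an element of [G], and transport becomes conjugation by it. *)
Lemma tr_G psi x : embedding psi -> G x -> G (tr psi x).
Proof.
move=> epsi Gx; have ipsi := epsi.1.
suff [] : [set y | G y /\ G (tr psi y)] x by [].
apply: small_gen Gx.
  apply: (homeo_subgroup_sub hG).
  - by move=> ? [].
  - by split; rewrite ?tr1 //; exact: sub1.
  - move=> f g [Gf Gtf] [Gg Gtg]; split; first exact: (subM hG Gf Gg).
    by rewrite trM //; exact: (subM hG Gtf Gtg).
  - move=> f [Gf Gtf]; split; first exact: (subV hG Gf).
    by rewrite trV //; exact: (subV hG Gtf).
move=> y Gy [W [cW W0 yW]]; split => //.
have [||g Gg gE] := @emb_extend psi (~` W) epsi; first exact: clopenN.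
  by rewrite setCK.
rewrite (tr_conj ipsi Gg gE) ?setCK //; exact: sub_conj.
Qed.

(** [K] contains the rigid stabilizers in [G] of the clopen subsets of [D] that leave part of [D]
    uncovered. The uncovered part is the room that vigour needs. *)
Definition contains_rist (K : set (CS -> CS)) (D : set CS) := forall A y,
  clopen A -> A `<=` D -> D `\` A !=set0 -> G y -> fixes y (~` A) -> K y.

(** An element supported in [A] is the transport of its conjugate by [hinv g], where [g] in [G]
    extends [psi] from the preimage of [A]. *)
Lemma rist_tr K psi : embedding psi -> (forall x, G x -> K (tr psi x)) ->
  contains_rist K (range psi).
Proof.
move=> epsi KG A y cA AD [q [[p _ pq] nAq]] Gy yf.
have ipsi := epsi.1.
pose A' := psi @^-1` A.
have cA' : clopen A' by apply: preimage_clopen => //; exact: (loc_cont epsi.2).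
have [|g Gg gE] := @emb_extend psi A' epsi cA'.
  by exists p; rewrite /A' /= pq.
have gA x : A x -> A' (hinv g x).
  move=> Ax; have [z _ zx] := AD _ Ax.
  suff -> : hinv g x = z by rewrite /A' /= zx.
  by rewrite -zx -gE ?gK // /A' /= zx.
have Gx : G (conj_by (hinv g) y) by apply: (sub_conj hG) => //; exact: subV.
suff -> : y = tr psi (conj_by (hinv g) y) by exact: KG.
rewrite (tr_conj (A := A') ipsi Gg gE) //.
  by apply/funext => x; rewrite /conj_by /= (subVV hG) // !gVK.
move=> x nx; rewrite /conj_by /= (subVV hG) // yf ?gK // => Ax.
by apply: nx; have := gA _ Ax; rewrite gK.
Qed.

(** * The full group and its commutators *)

Definition full f := [/\ cancel f (hinv f), cancel (hinv f) f & loc_in f setT].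

Lemma full_emb f : full f -> embedding f.
Proof. by case=> fK _ lf; split => //; exact: can_inj fK. Qed.

Lemma G_full f : G f -> full f.
Proof. by move=> Gf; split; [exact: gK|exact: gVK|exact: G_loc]. Qed.

Lemma fullP f g : cancel f g -> cancel g f -> loc_in f setT -> full f.
Proof. by move=> fK gfK lf; split => //; rewrite (cancel_hinv fK gfK). Qed.

Lemma fullM f g : full f -> full g -> full (f \o g).
Proof.
move=> [fK fVK lf] [gK' gVK' lg].
apply: (fullP (g := hinv g \o hinv f)).
- by move=> x /=; rewrite fK gK'.
- by move=> x /=; rewrite gVK' fVK.
- exact: (loc_comp (B := setT)).
Qed.

Lemma fullV f : full f -> full (hinv f).
Proof.
move=> [fK fVK lf]; apply: (fullP (g := f)) => // p _.
have [V [g [cV Vp Gg gE]]] := lf (hinv f p) I.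
exists (hinv g @^-1` V), (hinv g); split.
- by apply: (clopen_preim hG) => //; exact: subV.
- by rewrite /= -[X in hinv g X](fVK p) gE // gK.
- exact: subV.
- by move=> x /= Vx; rewrite -[in LHS](gVK Gg x) -gE // fK.
Qed.

(** For a bijection [f], transport along [f] is conjugation by [f]; hence the full group normalizes
    [G]. *)
Lemma full_conj f x : full f -> G x -> G (conj_by f x).
Proof.
move=> ff Gx; have [fK fVK lf] := ff.
suff <- : tr f x = conj_by f x by apply: tr_G => //; exact: full_emb.
apply: (tr_ext (psi := f)) => [p||]; last 2 first.
- exact: tr_out.
- by move=> q []; exists (hinv f q).
by rewrite tr_in ?/conj_by /= ?fK //; exact: can_inj fK.
Qed.

Lemma full_inj f : full f -> injective f. Proof. by case=> /can_inj. Qed.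

(** First [f1 = hinv g \o f] fixes a spike. Then [f1 = comm f1 h \o f'] with [f'] the conjugate of
    [f1] by [h], which is supported in [V], and [comm f1 h] is in [G] because the full group
    normalizes [G]. *)
Lemma full_shrink f V : full f -> clopen V -> V !=set0 ->
  exists g f', [/\ G g, full f', fixes f' (~` V) & f = g \o f'].
Proof.
move=> ff cV V0; have [x0 x0P] := spike_neq0 0; have [x1 x1P] := spike_neq0 1.
have x1N : ~ spike 0 x1 by move/(spike_disj x1P).
have [|g Gg gE] := @emb_extend f (spike 0) (full_emb ff) (clopen_spike 0).
  by exists x1.
have [V' [cV' V'V V'0 [v [Vv nv]]]] := clopen_split cV V0.
have [||||||h [Gh _ hV]] := @vig setT (~` spike 0) V' clopenT _ cV' _ _ _ _ V'0 _.
- exact/clopenN/clopen_spike.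
- by [].
- by exists x1.
- by exists x0; split => //; apply.
- by [].
- by exists v.
pose f1 := hinv g \o f.
have ff1 : full f1 by apply: fullM => //; apply: G_full; exact: subV.
have f1f : fixes f1 (spike 0) by move=> x xP; rewrite /f1 /= -gE // gK.
have [f1K f1VK _] := ff1.
pose f' := conj_by h f1.
have Vf' : hinv f' = conj_by h (hinv f1).
  by apply: cancel_hinv => x; rewrite /f' /conj_by /= gK // ?f1K ?f1VK gVK.
exists (g \o comm f1 h), f'; split.
- apply: (subM hG Gg); rewrite /comm -[_ \o hinv f1]/(conj_by f1 h).
  by apply: (subM hG); [exact: full_conj|exact: subV].
- by apply: fullM; [apply: fullM => //; exact: G_full|apply: G_full; exact: subV].
- move=> x nx; rewrite /f' /conj_by /= f1f ?gVK //; apply: contrapT => hx.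
  by apply: nx; apply: V'V; rewrite -(gVK Gh x); exact: hV.
- apply/funext => x; rewrite /comm /f' /conj_by /= gK // f1K gVK //.
  by rewrite /f1 /= gVK.
Qed.

(** Modulo [G], the maps [f] and [r] become [f1] and [f2] with disjoint supports. These commute, and
    the commutator collapses to a product of [g1], [g2] and conjugates of them or their inverses by
    full elements. *)
Lemma full_comm f r : full f -> full r -> G (comm f r).
Proof.
move=> ff fr.
have [g1 [f1 [Gg1 ff1 f1f fE]]] := full_shrink ff (clopen_spike 0) (spike_neq0 0).
have [g2 [f2 [Gg2 ff2 f2f rE]]] := full_shrink fr (clopen_spike 1) (spike_neq0 1).
have [f1K f1VK _] := ff1; have [f2K f2VK _] := ff2.
have fVE : hinv f = hinv f1 \o hinv g1.
  by rewrite fE; apply: cancel_hinv => x /=; [rewrite gK // f1K|rewrite f1VK gVK].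
have rVE : hinv r = hinv f2 \o hinv g2.
  by rewrite rE; apply: cancel_hinv => x /=; [rewrite gK // f2K|rewrite f2VK gVK].
suff -> : comm f r = g1 \o conj_by f1 g2 \o conj_by f2 (hinv g1) \o hinv g2.
  apply: (subM hG); last exact: (subV hG Gg2).
  apply: (subM hG); last by apply: full_conj => //; exact: subV.
  by apply: (subM hG) => //; exact: full_conj.
apply/funext => x; rewrite /comm /conj_by fVE rVE fE rE /=.
congr (g1 (f1 (g2 _))); apply: (@disjoint_commute _ _ (spike 1) (spike 0)) => //.
- exact: full_inj.
- exact: (can_inj f1VK).
- by apply: fixesV f1f; exact: full_inj.
- by move=> y y1 /(spike_disj y1).
Qed.

(** * Permuting the levels of a tower *)

Section Towers.
Variables (I : finType) (B : set CS) (g : I -> CS -> CS).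
Hypotheses (cB : clopen B) (Gg : forall i, G (g i)).
Hypothesis g_disj : forall i j x y, B x -> B y -> g i x = g j y -> i = j.

Definition tower_pt (q : CS) := exists iy : I * CS, B iy.2 /\ g iy.1 iy.2 = q.

Definition tower_map (s : I -> I) (q : CS) : CS :=
  if pselect (tower_pt q) is left p then let iy := projT1 (cid p) in g (s iy.1) iy.2
  else q.

Lemma tower_in s i y : B y -> tower_map s (g i y) = g (s i) y.
Proof.
move=> By; rewrite /tower_map; case: pselect => [p|[]]; last by exists (i, y).
case: (cid p) => -[j z] /= [Bz gE]; have ij := g_disj Bz By gE.
by subst j; have /(sub_inj hG (Gg i)) -> := gE.
Qed.

Lemma tower_out s q : ~ tower_pt q -> tower_map s q = q.
Proof. by rewrite /tower_map; case: pselect. Qed.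

Lemma tower_id : tower_map id = id.
Proof.
apply/funext => q; case: (pselect (tower_pt q)) => [[[i y] [/= By <-]]|nq].
  by rewrite tower_in.
by rewrite tower_out.
Qed.

Lemma towerM s t : tower_map (s \o t) = tower_map s \o tower_map t.
Proof.
apply/funext => q; case: (pselect (tower_pt q)) => [[[i y] [/= By <-]]|nq] /=.
  by rewrite !tower_in.
by rewrite !(tower_out _ nq).
Qed.

Lemma tower_iter s k : iter k (tower_map s) = tower_map (iter k s).
Proof.
elim: k => [|k IH]; first by rewrite tower_id.
by rewrite (_ : iter k.+1 s = s \o iter k s) // towerM -IH.
Qed.

Lemma clopen_tower : clopen tower_pt.
Proof.
suff H (s : seq I) : clopen [set q | exists2 i, i \in s & (g i @` B) q].
  rewrite (_ : tower_pt = [set q | exists2 i, i \in enum I & (g i @` B) q]) //.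
  apply/seteqP; split=> q.
    by case=> -[i y] [/= By <-]; exists i; rewrite ?mem_enum //; exists y.
  by case=> i _ [y By <-]; exists (i, y).
elim: s => [|i s IH].
  by rewrite (_ : [set _ | _] = set0) -?subset0; [exact: clopen0|move=> q []].
rewrite (_ : [set _ | _] = g i @` B `|` [set q | exists2 i, i \in s & (g i @` B) q]).
  by apply: clopenU => //; exact: (clopen_img hG).
apply/seteqP; split=> q.
  by case=> j; rewrite inE => /predU1P[->|js] Bj; [left|right; exists j].
case=> [Bi|[j js Bj]]; first by exists i; rewrite ?inE ?eqxx.
by exists j; rewrite // inE js orbT.
Qed.

Lemma tower_loc s : loc_in (tower_map s) setT.
Proof.
move=> q _; case: (pselect (tower_pt q)) => [[[i y] [/= By <-]]|nq].
  exists (g i @` B), (g (s i) \o hinv (g i)); split.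
  - exact: (clopen_img hG).
  - by exists y.
  - by apply: (subM hG) => //; exact: subV.
  - by move=> _ [z Bz <-] /=; rewrite tower_in // gK.
exists (~` tower_pt), id; split => //; first exact/clopenN/clopen_tower.
  exact: sub1.
by move=> x nx; rewrite tower_out.
Qed.

Lemma tower_full s t : cancel s t -> cancel t s ->
  full (tower_map s) /\ hinv (tower_map s) = tower_map t.
Proof.
move=> sK tK.
have K1 : cancel (tower_map s) (tower_map t).
  move=> q; have := congr1 (@^~ q) (towerM t s).
  by rewrite (_ : t \o s = id) ?tower_id //; apply/funext => i /=.
have K2 : cancel (tower_map t) (tower_map s).
  move=> q; have := congr1 (@^~ q) (towerM s t).
  by rewrite (_ : s \o t = id) ?tower_id //; apply/funext => i /=.
by split; [apply: fullP K1 K2 _; exact: tower_loc|exact: cancel_hinv].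
Qed.

End Towers.

(** * Elements of finite order and generation by their commutators *)

Lemma val_iter_ordS m k (i : 'I_m) : val (iter k (@ordS m) i) = ((i + k) %% m)%N.
Proof.
elim: k => [|k IH]; first by rewrite addn0 modn_small.
by rewrite iterS /= IH -addn1 modnDml addn1 addnS.
Qed.

Lemma iter_ordS_id m (i : 'I_m) : iter m (@ordS m) i = i.
Proof. by apply: val_inj; rewrite val_iter_ordS modnDr modn_small. Qed.

Lemma spread : exists g : nat -> CS -> CS, [/\ forall i, G (g i), g 0%N = id &
  forall i x, spike 0 x -> spike i (g i x)].
Proof.
have [x0 x0P] := spike_neq0 0.
have /choice[g gP] : forall i, exists f, [/\ G f, (i = 0)%N -> f = id &
    forall x, spike 0 x -> spike i (f x)].
  case=> [|i]; first by exists id; split => //; exact: sub1.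
  have [x1 x1P] := spike_neq0 i.+1.
  have [||h Gh hP] := vigT (clopen_spike 0) (clopen_spike i.+1) (spike_neq0 _)
    _ (spike_neq0 _).
  - by exists x1 => /(spike_disj x1P).
  - by exists x0 => /(spike_disj x0P).
  - by exists h.
exists g; split=> [i||i x xP]; first by have [] := gP i.
  by have [_ ->] := gP 0.
by have [_ _] := gP i; apply.
Qed.

Lemma iter_conj h a k x : G h -> iter k (conj_by h a) x = h (iter k a (hinv h x)).
Proof.
by move=> Gh; elim: k => /= [|k ->]; rewrite ?gVK // /conj_by /= gK.
Qed.

(** The cycle [c] of [n] spikes is only known to be in the full group. Its commutator with an [h]
    moving the tower into [spike n] is in [G], and equals [c] times a conjugate of its inverse with
    disjoint support, so it has the order of [c]. *)
Lemma exists_order n : (1 < n)%N -> exists a, [/\ G a, forall x, iter n a x = x,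
  exists p, [/\ spike 0 p, spike 1 (a p) &
    forall k, (0 < k)%N -> (k < n)%N -> iter k a p <> p] &
  fixes a (spike n.+1)].
Proof.
move=> n1; have n0 : (0 < n)%N by exact: ltnW.
have [g [Gg g0 gP]] := spread.
have gd (i j : 'I_n) x y : spike 0 x -> spike 0 y -> g i x = g j y -> i = j.
  move=> x0 y0 xy; apply: val_inj; apply: (spike_disj (gP i x x0)).
  by rewrite xy; exact: gP.
pose tm := tower_map (spike 0) (fun i : 'I_n => g i).
pose c := tm (@ordS n).
have [fc cV] := tower_full (clopen_spike 0) (fun i : 'I_n => Gg i) gd (@ordSK n) (@ord_predK n).
rewrite -/tm -/c in fc cV.
pose Q := tower_pt (spike 0) (fun i : 'I_n => g i).
have cQ : clopen Q by apply: clopen_tower => //; exact: clopen_spike.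
have Qs q : Q q -> exists2 i, (i < n)%N & spike i q.
  by case=> -[i y] [/= By <-]; exists (i : nat) => //; exact: (gP i y By).
have [x0 x0P] := spike_neq0 0; have [x1 x1P] := spike_neq0 n.+1.
have [xn xnP] := spike_neq0 n.
have Qx0 : Q x0 by exists (Ordinal n0, x0); rewrite /= g0.
have Qn q : spike n q -> ~ Q q.
  by move=> qn /Qs [i + /(spike_disj qn) iE]; rewrite iE ltnn.
have Qn1 q : spike n.+1 q -> ~ Q q.
  by move=> qn /Qs [i + /(spike_disj qn) iE]; rewrite -iE ltnNge leqW.
have [|||h Gh hP] := vigT cQ (clopen_spike n) _ _ (spike_neq0 n).
- by exists x0.
- by exists x1; exact: Qn1.
- by exists x0 => /(spike_disj x0P) n_0; rewrite -n_0 in n0.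
pose c' := conj_by h (hinv c).
have cf : fixes c (~` Q) by move=> q; exact: tower_out.
have [cK cVK _] := fc.
have c'f : fixes c' (~` spike n).
  move=> q nq; rewrite /c' /conj_by /= (fixesV (full_inj fc) cf) ?gVK // => /hP.
  by rewrite gVK.
have Qnspike q : Q q -> ~ spike n q by move=> Qq /Qn.
have Ga : G (c \o c').
  rewrite (_ : c \o c' = comm c h); first by apply: full_comm => //; exact: G_full.
  by apply/funext.
have c'I : injective c'.
  apply: inj_comp; last exact: can_inj (gVK Gh).
  by apply: inj_comp; [exact: sub_inj Gh|exact: can_inj cVK].
have cc' x : c (c' x) = c' (c x).
  exact: (@disjoint_commute c c' Q (spike n) x (full_inj fc) c'I cf c'f Qnspike).
have cn : iter n c = id.
  rewrite /c tower_iter // (_ : iter n _ = id) ?tower_id //.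
  by apply/funext => i; exact: iter_ordS_id.
have cVn x : iter n (hinv c) x = x.
  by have := iter_can n cK x; rewrite cn.
have x0c' k : iter k c' x0 = x0.
  elim: k => //= k ->; apply: c'f => /(spike_disj x0P) n_0.
  by rewrite -n_0 in n0.
have x0c k : (k < n)%N -> spike k (iter k (c \o c') x0).
  move=> kn; rewrite iter_commute // x0c' /c tower_iter //.
  rewrite -[x0](_ : g (Ordinal n0) x0 = x0); last by rewrite /= g0.
  rewrite tower_in //; have vk : nat_of_ord (iter k (@ordS n) (Ordinal n0)) = k.
    by have := val_iter_ordS k (Ordinal n0); rewrite add0n modn_small.
  by rewrite vk; exact: gP.
exists (c \o c'); split => //.
- by move=> x; rewrite iter_commute // cn iter_conj // cVn gVK.
- exists x0; split => //; first exact: (x0c 1%N).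
  move=> k k0 kn kx0; have := x0c k kn; rewrite kx0 => /(spike_disj x0P) k_0.
  by rewrite -k_0 in k0.
- move=> x xP /=; rewrite c'f; first by apply: cf; exact: Qn1.
  by move/(spike_disj xP)/eqP; rewrite eqn_leq ltnn.
Qed.

Definition torsion_comm n := [set f | exists a b, [/\ G a, G b,
  forall x, iter n a x = x, forall x, iter n b x = x & f = comm a b]].

Lemma conj_comm h a b : G h -> G a -> G b ->
  conj_by h (comm a b) = comm (conj_by h a) (conj_by h b).
Proof.
move=> Gh Ga Gb; rewrite /comm -!(conjV hG) //.
by apply/funext => x; rewrite /conj_by /= !gK.
Qed.

Lemma torsion_comm_gen n : (1 < n)%N -> gen (torsion_comm n) = G.
Proof.
move=> n1; apply: (simple_gen hG sG).
- by move=> _ [a [b [Ga Gb _ _ ->]]]; exact: sub_comm.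
- move=> g _ Gg [a [b [Ga Gb an bn ->]]].
  exists (conj_by g a), (conj_by g b); split.
  + exact: sub_conj.
  + exact: sub_conj.
  + by move=> x; rewrite iter_conj // an gVK.
  + by move=> x; rewrite iter_conj // bn gVK.
  + exact: conj_comm.
have [a [Ga an [p [p0 ap1 apk]] afix]] := exists_order n1.
have nspike k l x : spike k x -> k <> l -> ~ spike l x.
  by move=> xk kl /(spike_disj xk).
have [x1 x1P] := spike_neq0 n.+1.
have n_1 : (1 <> n.+1)%N by move=> [] n_0; rewrite -n_0 in n1.
have [||||k [Gk kf kP]] := @vig (~` spike 1) (spike 0) (spike n.+1)
  (clopenN (clopen_spike 1)) (clopen_spike 0) (clopen_spike n.+1) _ (spike_neq0 0)
  _ _ (spike_neq0 n.+1) _.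
- by move=> x x0; exact: nspike x0 _.
- by exists x1; split; apply: nspike x1P _ => // n_0; apply: n_1.
- by move=> x xn; apply: nspike xn _ => n_0; apply: n_1.
- by exists p; split; exact: nspike p0 _.
have bp : conj_by (hinv k) a p = p.
  by rewrite /conj_by /= (subVV hG) // afix ?gK //; exact: kP.
exists (comm a (conj_by (hinv k) a)).
  exists a, (conj_by (hinv k) a); split => //.
  - by apply: (sub_conj hG) => //; exact: subV.
  - by move=> x; rewrite iter_conj ?an ?gVK //; exact: subV.
have Gb : G (conj_by (hinv k) a) by apply: (sub_conj hG) => //; exact: subV.
set b := conj_by (hinv k) a in bp Gb *.
(* If the commutator were trivial, then, as [b] fixes [p], evaluation at [b (a p)] would show that
   [b] fixes [a p]. Since [k] fixes [a p], this gives [a (a p) = a p], hence [a p = p]. *)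
move=> /(congr1 (@^~ (b (a p)))); rewrite /comm /= !gK // bp.
rewrite /b /conj_by /= (subVV hG) // (kf (a p)); last by apply.
move=> /(congr1 k); rewrite gVK // (kf (a p)); last by apply.
by move=> /(sub_inj hG Ga) paE; apply: (apk 1%N) => //=.
Qed.

(** The elements generated by some finite subset of [S] form a subgroup, so each element of [gen S]
    needs only finitely many generators. *)
Lemma gen_finite S F : S `<=` G -> F `<=` gen S -> finite_set F ->
  exists S', [/\ finite_set S', S' `<=` S & F `<=` gen S'].
Proof.
move=> SG FS finF.
have H f : gen S f -> exists S', [/\ finite_set S', S' `<=` S & gen S' f].
  pose P := [set h | exists S', [/\ finite_set S', S' `<=` S & gen S' h]].
  have genS A B : A `<=` B -> gen A `<=` gen B.
    by move=> AB h hA H hH BH; apply: hA => // x /AB; exact: BH.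
  move=> /(_ P); apply; last first.
    move=> s Ss; exists [set s]; split => //; first by move=> _ ->.
    exact: gen_inc.
  apply: (homeo_subgroup_sub hG).
  - move=> h [S' [_ S'S]]; apply: gen_sub => //.
    by move=> x /S'S; exact: SG.
  - exists set0; split; [exact: finite_set0|exact: sub0set|].
    by move=> H hH _; exact: (sub1 hH).
  - move=> h k [S1 [f1 s1 h1]] [S2 [f2 s2 k2]]; exists (S1 `|` S2); split.
    + by rewrite finite_setU.
    + by move=> x [/s1|/s2].
    + have hS : homeo_subgroup (gen (S1 `|` S2)).
        by apply: (gen_subgroup hG) => x [/s1|/s2]; exact: SG.
      by apply: (subM hS); [apply: genS h1|apply: genS k2] => x; [left|right].
  - move=> h [S' [f' s' h']]; exists S'; split => //.
    have hS : homeo_subgroup (gen S') by apply: (gen_subgroup hG) => x /s'; exact: SG.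
    exact: (subV hS).
have /choice[T TP] : forall f, exists S', F f ->
    [/\ finite_set S', S' `<=` S & gen S' f].
  move=> f; case: (pselect (F f)) => [/FS/H[S' ?]|nF]; first by exists S'.
  by exists set0.
exists (\bigcup_(f in F) T f); split.
- by apply: bigcup_finite => // f /TP [].
- by move=> x [f /TP [_ TS _]] /TS.
- move=> f Ff H' hH' TH; have [_ _] := TP _ Ff; apply => // x Tx.
  by apply: TH; exists f.
Qed.

Lemma finite_torsion_comm n : finitely_generated G -> (1 < n)%N ->
  exists m (a b : nat -> CS -> CS),
    [/\ forall i, (i < m)%N -> [/\ G (a i), G (b i), forall x, iter n (a i) x = x &
          forall x, iter n (b i) x = x] &
        G `<=` gen [set f | exists2 i, (i < m)%N & f = comm (a i) (b i)]].
Proof.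
move=> [S [finS SG genS]] n1.
have tG : torsion_comm n `<=` G.
  by move=> _ [a [b [Ga Gb _ _ ->]]]; exact: sub_comm.
have [|S' [/finite_setP[m] mS' S't SS']] := gen_finite tG _ finS.
  by rewrite torsion_comm_gen.
have /card_set_bijP[c [cfun _ csurj]] : (`I_m #= S')%card by rewrite card_eq_sym.
have /choice[ab abP] : forall i, exists ab : (CS -> CS) * (CS -> CS), (i < m)%N ->
    [/\ G ab.1, G ab.2, forall x, iter n ab.1 x = x, forall x, iter n ab.2 x = x &
      c i = comm ab.1 ab.2].
  move=> i; case: (ltnP i m) => im; last by exists (id, id).
  have /S't [a [b abP]] := cfun _ im.
  by exists (a, b).
exists m, (fst \o ab), (snd \o ab); split => [i /abP []//|].
rewrite -[X in X `<=` _]genS => f Sf H hH tH; apply: Sf => // g Sg.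
apply: (SS' _ Sg) => // h /csurj [i im <-]; apply: tH; exists i => //.
by have [] := abP i im.
Qed.

(** * Combining disjoint pieces and isolating commutators *)

Lemma disjoint_union J (h : nat -> CS -> CS) (D : nat -> set CS) :
  (forall j, (j < J)%N -> G (h j) /\ fixes (h j) (~` D j)) ->
  (forall i j q, (i < J)%N -> (j < J)%N -> D i q -> D j q -> i = j) ->
  exists z, [/\ G z, forall j q, (j < J)%N -> D j q -> z q = h j q &
    forall q, (forall j, (j < J)%N -> ~ D j q) -> z q = q].
Proof.
elim: J => [|J IH] hP DP; first by exists id; split => //; exact: sub1.
have [j jJ|i j q iJ jJ|z [Gz zD zn]] := IH.
- by apply: hP; exact: ltnW.
- by apply: DP; exact: ltnW.
have [Gh hf] := hP J (ltnSn _).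
exists (z \o h J); split; first exact: subM.
- move=> j q; rewrite ltnS leq_eqVlt => /predU1P[->|jJ] Dq /=.
    apply: zn => i iJ Diq; have Dhq := fixes_stable (sub_inj hG Gh) hf Dq.
    by have iE := DP _ _ _ (ltnW iJ) (ltnSn J) Diq Dhq; rewrite iE ltnn in iJ.
  rewrite hf; first exact: zD.
  move=> DJq; have jE := DP _ _ _ (ltnW jJ) (ltnSn J) Dq DJq.
  by rewrite jE ltnn in jJ.
- move=> q nq /=; rewrite hf; last exact: nq.
  by apply: zn => i iJ; apply: nq; exact: ltnW.
Qed.

(* The parts of [u] and [v] outside [D] live on disjoint sets and cancel. *)
Lemma comm_isolate u v y z (D E F : set CS) : G u -> G v -> G y -> G z ->
  (forall q, D q -> u q = y q) -> (forall q, D q -> v q = z q) ->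
  fixes y (~` D) -> fixes z (~` D) ->
  fixes u (~` (D `|` E)) -> fixes v (~` (D `|` F)) ->
  (forall q, E q -> ~ F q) -> comm u v = comm y z.
Proof.
move=> Gu Gv Gy Gz uy vz yf zf uf vf EF.
have stab w x A q : G w -> G x -> (forall r, D r -> w r = x r) -> fixes x (~` D) ->
    fixes w (~` (D `|` A)) -> A q -> ~ D q -> A (w q) /\ ~ D (w q).
  move=> Gw Gx wx xf wf Aq nDq.
  have nD : ~ D (w q).
    move=> Dwq; have Dq' : D (hinv x (w q)).
      have xI := sub_inj hG Gx; have xVI := sub_inj hG (subV hG Gx).
      exact: (fixes_stable xVI (fixesV xI xf) Dwq).
    apply: nDq; suff -> : q = hinv x (w q) by [].
    by apply: (sub_inj hG Gw); rewrite (wx _ Dq') gVK.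
  split => //.
  have [//|//] : (D `|` A) (w q).
  by exact: (fixes_stable (sub_inj hG Gw) wf (or_intror Aq)).
have uvE q : u (v q) = comm y z (v (u q)).
  case: (pselect (D q)) => Dq.
    have Dy := fixes_stable (sub_inj hG Gy) yf Dq.
    have Dz := fixes_stable (sub_inj hG Gz) zf Dq.
    by rewrite vz // uy // uy // vz // /comm /= !gK.
  have wf r : ~ D r -> comm y z r = r.
    move=> nD; rewrite /comm /= (fixesV (sub_inj hG Gz) zf) //.
    by rewrite (fixesV (sub_inj hG Gy) yf) // zf // yf.
  case: (pselect (E q)) => Eq.
    have [Eu nDu] := stab u y E q Gu Gy uy yf uf Eq Dq.
    have vfE r : E r -> ~ D r -> v r = r by move=> Er nDr; apply: vf => -[//|/EF]; exact.
    by rewrite !vfE // wf.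
  case: (pselect (F q)) => Fq.
    have [Fv nDv] := stab v z F q Gv Gz vz zf vf Fq Dq.
    have ufF r : F r -> ~ D r -> u r = r by move=> Fr nDr; apply: uf => -[//|/EF]; exact.
    by rewrite !ufF // wf.
  have vq : v q = q by apply: vf => -[].
  have uq : u q = q by apply: uf => -[].
  by rewrite vq uq vq wf.
apply/funext => q; rewrite {1}/comm /=; rewrite uvE !gVK //.
Qed.

(** * Gluing rigid stabilizers *)

Lemma rist_sub K D D' : D' `<=` D -> contains_rist K D -> contains_rist K D'.
Proof.
move=> D'D KD A y cA AD' [q [Dq nAq]]; apply: KD => //.
  by move=> x /AD' /D'D.
by exists q; split => //; exact: D'D.
Qed.

Section RigidStabilizers.
Variables (K : set (CS -> CS)) (hK : homeo_subgroup K) (KG : K `<=` G).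

Lemma rist_img D k : K k -> contains_rist K D -> contains_rist K (k @` D).
Proof.
move=> Kk KD A y cA AD [_ [[p Dp <-] nAp]] Gy yf.
have Gk := KG Kk.
suff Ky : K (conj_by (hinv k) y).
  suff -> : y = conj_by k (conj_by (hinv k) y) by exact: (sub_conj hK).
  by apply/funext => x; rewrite /conj_by /= (subVV hG) // !gVK.
apply: (KD (k @^-1` A)).
- exact: (clopen_preim hG).
- by move=> x /= /AD [z Dz /(sub_inj hG Gk) <-].
- by exists p.
- by apply: (sub_conj hG) => //; exact: subV.
- by move=> x nx; rewrite /conj_by /= (subVV hG) // yf ?gK.
Qed.

(** An element [k] of [K] supported in [D2] squeezes [A] within [D2] into the overlap with [D1].
    Conjugating by [k] brings the support of [y] into a proper part of [D1]. *)
Lemma rist_union_aux D1 D2 A y : clopen D1 -> clopen D2 -> D1 `&` D2 !=set0 ->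
  contains_rist K D1 -> contains_rist K D2 -> clopen A -> A `<=` D1 `|` D2 -> D2 `\` A !=set0 ->
  G y -> fixes y (~` A) -> K y.
Proof.
move=> cD1 cD2 [i [D1i D2i]] K1 K2 cA AD Q0 Gy yf.
case: (pselect (A `&` D2 !=set0)) => [AD20|AD20]; last first.
  apply: (K1 A) => //.
    by move=> x Ax; case: (AD _ Ax) => // D2x; case: AD20; exists x.
  by exists i; split => // Ai; apply: AD20; exists i.
have cI : clopen (D1 `&` D2) by exact: clopenI.
(* [Q1] is kept fixed so that [k] has support proper in [D2]; it is chosen to leave room both in
   [D2] outside [A] and in the overlap. *)
have [Q1 [cQ1 Q1Q Q10 QQ1 IQ1]] : exists Q1 : set CS, [/\ clopen Q1, Q1 `<=` D2 `\` A,
    Q1 !=set0, (D2 `\` A) `\` Q1 !=set0 & (D1 `&` D2) `\` Q1 !=set0].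
  case: (pselect (D1 `&` D2 `&` (D2 `\` A) !=set0)) => [IO|IO].
    have [|F [cF FI F0 [x [xI nx]]]] := clopen_split _ IO.
      by apply: clopenI => //; exact: clopenD.
    by exists F; split => //; [move=> z /FI []|exists x; case: xI|exists x; case: xI].
  have [F [cF FI F0 OF]] := clopen_split (clopenD cD2 cA) Q0.
  exists F; split => //; exists i; split => // /FI Oi.
  by apply: IO; exists i.
(* The target [I'] omits a point [w] of the overlap, which later shows that the conjugated support
   is proper in [D1]. *)
have [I' [cI' I'I I'0 [w [[[D1w D2w] O1w] I'w]]]] := clopen_split (clopenD cI cQ1) IQ1.
have [|||||||||k [Gk kf kP]] := @vig (D2 `\` Q1) (A `&` D2) I'.
- exact: clopenD.
- exact: clopenI.
- by [].
- by move=> x [Ax D2x]; split => // /Q1Q [].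
- by [].
- by case: QQ1 => x [[D2x Ax] O1x]; exists x; split => // -[].
- by move=> x /I'I [[]].
- by [].
- by exists w.
have Kk : K k.
  apply: (K2 (D2 `\` Q1)) => //; first exact: clopenD.
  by case: Q10 => x O1x; exists x; split => [|[]//]; case: (Q1Q _ O1x).
suff Ky : K (conj_by k y).
  suff -> : y = conj_by (hinv k) (conj_by k y).
    by apply: (sub_conj hK) => //; exact: subV.
  by apply/funext => x; rewrite /conj_by /= (subVV hG) // !gK.
apply: (K1 ((A `\` D2) `|` I')).
- by apply: clopenU => //; exact: clopenD.
- by move=> x [[Ax D2x]|/I'I [[]//]]; case: (AD _ Ax).
- by exists w; split => // -[[]|].
- exact: sub_conj.
- move=> x nx; rewrite /conj_by /= yf ?gVK // => Ax; apply: nx.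
  case: (pselect (D2 (hinv k x))) => D2x.
    by right; rewrite -(gVK Gk x); exact: kP.
  left; have xE : hinv k x = x.
    by rewrite -[in RHS](gVK Gk x) kf // => -[].
  by rewrite -xE.
Qed.

Lemma rist_union D1 D2 : clopen D1 -> clopen D2 -> D1 `&` D2 !=set0 ->
  contains_rist K D1 -> contains_rist K D2 -> contains_rist K (D1 `|` D2).
Proof.
move=> cD1 cD2 D12 K1 K2 A y cA AD [q [[D1q|D2q] Aq]].
  apply: (rist_union_aux cD2 cD1) => //; [by rewrite setIC|by rewrite setUC|].
  by exists q.
by apply: (rist_union_aux cD1 cD2) => //; exists q.
Qed.

Lemma rist_setT : contains_rist K setT -> K = G.
Proof.
move=> KT; apply/seteqP; split => //; apply: small_gen => // g Gg [W [cW [w Ww] gW]].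
apply: (KT (~` W)) => //; first exact: clopenN.
- by exists w; split => //; apply.
- by rewrite setCK.
Qed.

End RigidStabilizers.

(** * A periodic tower covering the space *)

Lemma full_iter f k : full f -> full (iter k f).
Proof.
move=> ff; elim: k => [|k IH]; first by apply: G_full; exact: sub1.
exact: (fullM ff IH).
Qed.

Lemma full_img_clopen f A : full f -> clopen A -> clopen (f @` A).
Proof.
move=> ff cA; have [fK fVK _] := ff.
have -> : f @` A = hinv f @^-1` A.
  apply/seteqP; split => [_ [x Ax <-]|x Ax] /=; first by rewrite fK.
  by exists (hinv f x); rewrite ?fVK.
by apply: preimage_clopen => //; apply: loc_cont; have [_ _] := fullV ff.
Qed.

(* [f] is the [N]-cycle [c] on the levels [g i B] composed with the involution [t]
   that exchanges the complement [L] of the levels with a part of level 0.  The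
   reflection [r] of the levels inverts [c] and commutes with [t], so [t r] inverts
   [f] and [f^2] is a commutator of the full group. *)
Lemma exists_tower N : (1 < N)%N -> exists f (B : set CS),
  [/\ full f, G (f \o f), clopen B, B !=set0 &
  [/\ exists2 M, (0 < M)%N & forall x, iter M f x = x,
   forall i j x y, (i < N)%N -> (j < N)%N -> B x -> B y ->
     iter i f x = iter j f y -> i = j &
   forall q, exists i x, [/\ (i <= N)%N, B x & q = iter i f x]]].
Proof.
move=> N1; have N0 : (0 < N)%N by exact: ltnW.
have [g [Gg g0 gP]] := spread.
pose gN (i : 'I_N) := g i; pose B := spike 0.
have GgN i : G (gN i) by exact: Gg.
have cB : clopen B := clopen_spike 0.
have gd (i j : 'I_N) x y : B x -> B y -> gN i x = gN j y -> i = j.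
  move=> x0 y0 xy; apply: val_inj; apply: (spike_disj (gP i x x0)).
  by rewrite -/(gN i x) xy; exact: gP.
pose o0 := Ordinal N0.
have g0N x : gN o0 x = x by rewrite /gN /= g0.
pose c := tower_map B gN (@ordS N).
have [fc cV] := tower_full cB GgN gd (@ordSK N) (@ord_predK N).
rewrite -/c in fc cV.
(* The reflection is negation modulo [N]. It fixes 0, so [r] is the identity on level 0, which is
   why [r] commutes with [t]. *)
have rho_lt (i : 'I_N) : ((N - i) %% N < N)%N by rewrite ltn_mod.
pose rho (i : 'I_N) := Ordinal (rho_lt i).
have rhoK : involutive rho.
  move=> i; apply: val_inj => /=; case: (posnP i) => [->|i0].
    by rewrite subn0 modnn subn0 modnn.
  rewrite (modn_small (m := N - i)); last by rewrite ltn_subrL i0.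
  by rewrite subKn ?modn_small // ltnW.
have rhoS : rho \o @ord_pred N = @ordS N \o rho.
  apply/funext => i; apply: val_inj => /=; case: (posnP i) => [->|i0].
    rewrite add0n subn0 modnn (_ : N.-1 %% N = N.-1)%N; last by rewrite modn_small //; lia.
    by congr (_ %% _)%N; lia.
  have iN := ltn_ord i.
  have -> : ((i + N).-1 %% N = i.-1)%N.
    by rewrite -{1}(prednK i0) addSn /= modnDr modn_small // (leq_ltn_trans (leq_pred _)).
  rewrite (modn_small (m := N - i)); last by rewrite ltn_subrL i0.
  by congr (_ %% _)%N; lia.
pose r := tower_map B gN rho.
have [fr rV] := tower_full cB GgN gd rhoK rhoK.
rewrite -/r in fr rV.
have rK' : involutive r by have [+ _ _] := fr; rewrite rV.
have rc x : r (hinv c x) = c (r x).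
  have := congr1 (@^~ x) (towerM GgN gd rho (@ord_pred N)); rewrite rhoS.
  by rewrite (towerM GgN gd) -cV.
pose L := ~` tower_pt B gN.
have cL : clopen L by apply/clopenN/(clopen_tower cB GgN).
have LB x : L x -> ~ B x by move=> Lx Bx; apply: Lx; exists (o0, x).
have [x0 x0P] := spike_neq0 0; have [xN xNP] := spike_neq0 N.
have LN : L xN.
  case=> -[i y] [/= By yE]; have := gP i y By; rewrite -/(gN i y) yE.
  by move=> /(spike_disj xNP) NE; have := ltn_ord i; rewrite -NE ltnn.
have [|||lam Glam lamP] := vigT cL cB _ _ (spike_neq0 0).
- by exists xN.
- by exists x0; apply; exists (o0, x0).
- by exists xN; exact: LB.
pose e (b : bool) := if b then lam else id.
have Ge b : G (e b) by case: b => //=; exact: sub1.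
have ed (i j : bool) x y : L x -> L y -> e i x = e j y -> i = j.
  case: i j => -[] //= Lx Ly xy.
    by case: (LB _ Ly); rewrite -xy; exact: lamP.
  by case: (LB _ Lx); rewrite xy; exact: lamP.
pose t := tower_map L e negb.
have [ft tV] := tower_full cL Ge ed negbK negbK.
rewrite -/t in ft tV.
have tK : involutive t by have [+ _ _] := ft; rewrite tV.
have tl x : L x -> t x = lam x by move=> Lx; apply: (tower_in Ge ed negb false Lx).
have tlam x : L x -> t (lam x) = x by move=> Lx; apply: (tower_in Ge ed negb true Lx).
have tn x : ~ L x -> ~ B x -> t x = x.
  move=> nL nB; apply: tower_out => -[[[] y] [/= Ly yx]].
    by apply: nB; rewrite -yx; exact: lamP.
  by apply: nL; rewrite -yx.
have rt x : r (t x) = t (r x).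
  apply: (@disjoint_commute r t (~` (L `|` B)) (L `|` B)) => //.
  - exact: full_inj.
  - exact: full_inj.
  - move=> y; rewrite setCK => -[Ly|By]; first exact: tower_out.
    rewrite -(g0N y) /r tower_in //; congr (gN _ _).
    by apply: val_inj => /=; rewrite subn0 modnn.
  - by move=> y yn; apply: tn => H; apply: yn; [left|right].
pose f := t \o c.
have ff : full f by exact: fullM.
have [cK cVK _] := fc.
have fV : hinv f = hinv c \o t.
  by apply: cancel_hinv => x; rewrite /f /= ?tK ?cK ?cVK.
have levels i x : (i < N)%N -> B x -> iter i f x = g i x.
  move=> + Bx; elim: i => [|i IH] iN; first by rewrite g0.
  have o_lt := ltnW iN; rewrite iterS IH // /f /= -[g i]/(gN (Ordinal o_lt)).
  rewrite /c tower_in //.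
  have -> : gN (ordS (Ordinal o_lt)) = g i.+1 by rewrite /gN /= modn_small.
  apply: tn; last by move=> /(spike_disj (gP i.+1 x Bx)).
  by apply; exists (Ordinal iN, x).
have topE x : B x -> iter N f x = t x.
  move=> Bx; have pN : (N.-1 < N)%N by rewrite prednK.
  rewrite -{1}(prednK N0) iterS levels // /f /= -[g N.-1]/(gN (Ordinal pN)).
  rewrite /c tower_in //; congr (t _).
  suff -> : ordS (Ordinal pN) = o0 by exact: g0N.
  by apply: val_inj; rewrite /= prednK // modnn.
have cover q : exists i x, [/\ (i <= N)%N, B x & q = iter i f x].
  case: (pselect (L q)) => [Lq|/contrapT [[i y] [/= By <-]]].
    by exists N, (lam q); rewrite topE ?tlam //; [split => //|]; exact: lamP.
  by exists i, y; rewrite levels //; split => //; exact: ltnW.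
exists f, B; split => //.
- suff <- : comm f (t \o r) = f \o f by apply: full_comm => //; exact: fullM.
  have trV : hinv (t \o r) = r \o t.
    by apply: cancel_hinv => x /=; rewrite ?tK ?rK' ?tK.
  apply/funext => x; rewrite /comm trV fV /=.
  have E1 : t (r (t x)) = r x by rewrite -rt tK.
  by rewrite E1 rc rK'.
- exact: spike_neq0.
split.
(* A point of level 0 returns after [N] steps if [t] fixes it. A point [lam y] with [y] in [L] makes
   a detour through [y] and returns after [N + 1] steps. *)
- exists (N * N.+1)%N; first by rewrite muln_gt0 N0.
  have fixB x : B x -> iter (N * N.+1) f x = x.
    move=> Bx; case: (pselect (tower_pt L e x)) => [[[[] y] [/= Ly yx]]|nx].
    - apply: iter_mul_fix; rewrite iterS topE // -yx tlam // /f /=.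
      by rewrite (_ : c y = y) ?tl //; exact: tower_out.
    - by case: (LB _ Ly); rewrite yx.
    - by rewrite mulnC; apply: iter_mul_fix; rewrite topE //; exact: tower_out.
  move=> q; have [i [x [_ Bx ->]]] := cover q.
  by rewrite -iterD addnC iterD fixB.
- move=> i j x y iN jN Bx By; rewrite !levels // => xy.
  by apply: (spike_disj (gP i x Bx)); rewrite xy; exact: gP.
- exact: cover.
Qed.

(** * Construction of the two generators *)

Lemma tr_iter psi x k : injective psi -> iter k (tr psi x) = tr psi (iter k x).
Proof.
move=> ipsi; elim: k => [|k IH]; first exact: esym (tr1 ipsi).
have -> : iter k.+1 x = x \o iter k x by [].
by rewrite (trM _ _ ipsi) -IH.
Qed.

Lemma tr_comm psi x y : injective psi -> G x -> G y ->
  tr psi (comm x y) = comm (tr psi x) (tr psi y).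
Proof.
move=> ipsi Gx Gy.
by rewrite /comm 3!(trM _ _ ipsi) (trV ipsi Gx) (trV ipsi Gy).
Qed.

Lemma iter_double (f : CS -> CS) s x : iter s (f \o f) x = iter s.*2 f x.
Proof. by elim: s => //= s ->. Qed.

Lemma sum_pow3_le i j k l : (i <= k)%N -> (j <= l)%N ->
  (3 ^ i + 3 ^ k = 3 ^ j + 3 ^ l)%N -> i = j /\ k = l.
Proof.
have lt3 a b c : (a <= b)%N -> (b < c)%N -> (3 ^ a + 3 ^ b < 3 ^ c)%N.
  move=> ab bc; have H1 : (3 ^ a <= 3 ^ b)%N by rewrite leq_exp2l.
  have H2 : (3 ^ b.+1 <= 3 ^ c)%N by rewrite leq_exp2l.
  have H3 : (0 < 3 ^ b)%N by rewrite expn_gt0.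
  by rewrite expnS in H2; lia.
move=> ik jl E; have kl : k = l.
  by case: (ltngtP k l) => // [/(lt3 _ _ _ ik)|/(lt3 _ _ _ jl)]; lia.
split=> //; subst l; apply/eqP; rewrite -(eqn_exp2l (m := 3)) //; apply/eqP; lia.
Qed.

(** The powers of 3 form a Sidon set: [3 ^ a + 3 ^ b < 3 ^ c] for [a <= b < c], so the size of a sum
    reveals its larger exponent. *)
Lemma sum_pow3 i j k l : (3 ^ i + 3 ^ k = 3 ^ j + 3 ^ l)%N ->
  (i = j /\ k = l) \/ (i = l /\ k = j).
Proof.
move=> E; case: (leqP i k) => ik; case: (leqP j l) => jl.
- by left; apply: sum_pow3_le.
- by right; apply: sum_pow3_le => //; [exact: ltnW|rewrite E addnC].
- by right; have [-> ->] := sum_pow3_le (ltnW ik) jl (etrans (addnC _ _) E).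
- left; have E' := etrans (etrans (addnC _ _) E) (addnC _ _).
  by have [-> ->] := sum_pow3_le (ltnW ik) (ltnW jl) E'.
Qed.

Lemma two_generated n : finitely_generated G -> (1 < n)%N ->
  exists sigma zeta : CS -> CS,
    [/\ G sigma, G zeta, finite_order sigma, has_order zeta n &
        gen [set f | f = sigma \/ f = zeta] = G].
Proof.
move=> fg n1; have n0 : (0 < n)%N by exact: ltnW.
have [m [a [b [abP abG]]]] := finite_torsion_comm fg n1.
have [a0 [Ga0 a0n [p0 [_ _ p0k]] _]] := exists_order n1.
(* Indices [2i] and [2i + 1] carry [a i] and [b i]. The last index [2m] carries [a0], whose exact
   order [n] forces that of [zeta]. *)
pose J := m.*2.+1.
pose xs j := if (j < m.*2)%N then (if odd j then b j./2 else a j./2) else a0.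
have xsP j : G (xs j) /\ forall x, iter n (xs j) x = x.
  rewrite /xs; case: ltnP => // jm.
  have [Ga Gb an bn] : [/\ G (a j./2), G (b j./2), forall x, iter n (a j./2) x = x &
     forall x, iter n (b j./2) x = x] by apply: abP; lia.
  by case: odd.
(* Translates [Us s] and [Us t] may meet when [s] and [t] differ by 1. The factor 2 makes all shifts
   even, so a meeting forces equality of sums of powers of 3. *)
pose pos j := (2 * 3 ^ j)%N.
(* A sum of two shifts is at most [4 * 3 ^ J], and [sigma] climbs two levels, so all translates of
   [U] in use stay below level [N]. *)
pose N := (8 * 3 ^ J + 8)%N.
have [|f [B [ff Gs cB B0 [[M M0 fM] fdisj fcov]]]] := @exists_tower N.
  by rewrite /N; lia.
have [x0 Bx0] := B0; have fI k : injective (iter k f) := full_inj (full_iter k ff).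
pose lv i := iter i f @` B.
have clv i : clopen (lv i) by exact: full_img_clopen (full_iter i ff) cB.
have lvI i j q : (i < N)%N -> (j < N)%N -> lv i q -> lv j q -> i = j.
  by move=> iN jN [x Bx <-] [y By xy]; apply: (fdisj i j x y).
have N8 : (8 <= N)%N by rewrite /N; lia.
(* Three levels against a step of two: [P] and its image under [sigma] share level 2. *)
pose P := lv 0 `|` lv 1 `|` lv 2.
have cP : clopen P by do 2?apply: clopenU.
have lvP q : lv 3 q -> ~ P q.
  move=> q3; have H i : (i < 3)%N -> ~ lv i q.
    move=> i3 qi; have iN : (i < N)%N by lia.
    have N3 : (3 < N)%N by lia.
    by have := lvI _ _ _ N3 iN q3 qi; lia.
  by case=> [[]|]; apply: H.
pose U := [set q | exists2 i, (i <= 3)%N & lv i q].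
have lv3 : lv 3 (iter 3 f x0) by exists x0.
have Bx0P : P x0 by left; left; exists x0.
have [|||phi Gphi phiP] := vigT (clopenN cP) (clv 3) _ _ (ex_intro _ _ lv3).
- by exists (iter 3 f x0); exact: lvP.
- by exists x0; apply.
- by exists x0 => /lvP.
(* The identity on [P], with everything else pushed into level 3; this squeezes the whole space into
   levels 0 to 3. *)
pose psi q := if pselect (P q) then q else phi q.
have psi1 q : P q -> psi q = q by rewrite /psi; case: pselect.
have psi2 q : ~ P q -> psi q = phi q by rewrite /psi; case: pselect.
have ipsi : injective psi.
  move=> x y; case: (pselect (P x)) => Px; case: (pselect (P y)) => Py.
  - by rewrite !psi1.
  - by rewrite psi1 // psi2 // => xy; have := phiP _ Py; rewrite -xy => /lvP.
  - by rewrite psi2 // psi1 // => xy; have := phiP _ Px; rewrite xy => /lvP.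
  - by rewrite !psi2 // => /(sub_inj hG Gphi).
have epsi : embedding psi.
  split=> // q _; case: (pselect (P q)) => Pq.
    by exists P, id; split => //; exact: sub1.
  by exists (~` P), phi; split => //; exact: clopenN.
have psiU : range psi `<=` U.
  move=> _ [q _ <-]; case: (pselect (P q)) => Pq.
    by rewrite psi1 //; case: Pq => [[]|] q'; [exists 0%N|exists 1%N|exists 2].
  by rewrite psi2 //; exists 3 => //; exact: phiP.
have Ppsi : P `<=` range psi by move=> q Pq; exists q; rewrite ?psi1.
pose sig s := iter s (f \o f).
have Gsig s : G (sig s) by exact: sub_iter.
have sigD s t x : sig (s + t)%N x = sig s (sig t x) by rewrite /sig iterD.
pose Us s := sig s @` U.
have UsP s q : Us s q -> exists2 i, (i <= 3)%N & lv (s.*2 + i)%N q.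
  move=> [_ [i i3 [x Bx <-]] <-]; exists i => //; exists x => //.
  by rewrite /sig iter_double iterD.
have Usdisj s t q : (s.*2 + 3 < N)%N -> (t.*2 + 3 < N)%N -> Us s q -> Us t q ->
    (s <= t.+1)%N /\ (t <= s.+1)%N.
  move=> sN tN /UsP [i i3 qi] /UsP [j j3 qj].
  have := lvI _ _ _ _ _ qi qj => H.
  suff : (s.*2 + i = t.*2 + j)%N by lia.
  by apply: H; lia.
have pow3 j : (j < J)%N -> (3 ^ j <= 3 ^ J)%N by move=> jJ; rewrite leq_exp2l // ltnW.
have Us2 i j k l q : (i < J)%N -> (j < J)%N -> (k < J)%N -> (l < J)%N ->
    Us (pos i + pos k)%N q -> Us (pos j + pos l)%N q -> (i = j /\ k = l) \/ (i = l /\ k = j).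
  move=> /pow3 i3 /pow3 j3 /pow3 k3 /pow3 l3 q1 q2; apply: sum_pow3.
  have := Usdisj _ _ _ _ _ q1 q2; rewrite /pos /N => H.
  have [] : (2 * 3 ^ i + 2 * 3 ^ k <= (2 * 3 ^ j + 2 * 3 ^ l).+1 /\
    2 * 3 ^ j + 2 * 3 ^ l <= (2 * 3 ^ i + 2 * 3 ^ k).+1)%N by apply: H; lia.
  by lia.
have Us1 i j q : (i < J)%N -> (j < J)%N -> Us (pos i) q -> Us (pos j) q -> i = j.
  move=> iJ jJ [x Ux xq] [y Uy yq].
  have H k z : U z -> sig (pos k) z = q -> Us (pos k + pos k)%N (sig (pos k) q).
    by move=> Uz <-; exists z; rewrite // sigD.
  have Hj : Us (pos j + pos i)%N (sig (pos i) q).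
    by exists y; rewrite // addnC sigD yq.
  by have [[]|[]] := Us2 _ _ _ _ _ iJ jJ iJ iJ (H _ _ Ux xq) Hj.
pose y j := tr psi (xs j).
have Gy j : G (y j) by apply: tr_G => //; have [] := xsP j.
have yf j : fixes (y j) (~` U) by move=> q nq; apply: tr_out => /psiU.
have yn j q : iter n (y j) q = q.
  rewrite /y tr_iter // (_ : iter n (xs j) = id) ?tr1 //.
  by apply/funext => x; have [_] := xsP j; apply.
pose pl s w := conj_by (sig s) w.
have Gpl s w : G w -> G (pl s w) by move=> Gw; exact: (sub_conj hG).
have plE s w z : pl s w (sig s z) = sig s (w z) by rewrite /pl /conj_by /= gK.
have plf s w : fixes w (~` U) -> fixes (pl s w) (~` Us s).
  move=> wf q nq; rewrite /pl /conj_by /= wf ?gVK // => Uq.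
  by apply: nq; exists (hinv (sig s) q); rewrite ?gVK.
have [||z [Gz zU zn]] := @disjoint_union J (fun j => pl (pos j) (y j))
    (fun j => Us (pos j)).
- by move=> j jJ; split; [exact: Gpl|exact: plf].
- by move=> i j q iJ jJ; exact: Us1.
have shift_in t j q : (j < J)%N -> Us (t + pos j)%N q ->
    conj_by (sig t) z q = pl (t + pos j)%N (y j) q.
  move=> jJ [x Ux <-]; rewrite plE !(sigD t) /conj_by /= gK // (zU j) ?plE //.
  by exists x.
have shift_out t q : (forall j, (j < J)%N -> ~ Us (t + pos j)%N q) ->
    conj_by (sig t) z q = q.
  move=> nq; rewrite /conj_by /= zn ?gVK // => j jJ [x Ux xE].
  by apply: (nq j jJ); exists x; rewrite // sigD xE gVK.
pose K := gen [set g | g = f \o f \/ g = z].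
have SG : [set g | g = f \o f \/ g = z] `<=` G by move=> g [->|->].
have hK : homeo_subgroup K := gen_subgroup hG SG.
have KG : K `<=` G := gen_sub hG SG.
have Ks : K (f \o f) by apply: gen_inc; left.
have Kz : K z by apply: gen_inc; right.
have Ksig t : K (sig t) by exact: (sub_iter hK).
have Kcomm j k : (j < J)%N -> (k < J)%N -> j <> k -> K (comm (y j) (y k)).
  (* Shifting [z] by [pos k] puts piece [j] at position [s], and shifting it by [pos j] puts piece
     [k] there. By the Sidon property all other pieces of the two shifts are disjoint. *)
  move=> jJ kJ jk; pose s := (pos k + pos j)%N.
  suff Kpl : K (pl s (comm (y j) (y k))).
    have -> : comm (y j) (y k) = conj_by (hinv (sig s)) (pl s (comm (y j) (y k))).
      by apply/funext => x; rewrite /pl /conj_by /= (subVV hG) // !gK.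
    by apply: (sub_conj hK) => //; exact: (subV hK).
  rewrite /pl conj_comm // -!/(pl _ _).
  suff <- : comm (conj_by (sig (pos k)) z) (conj_by (sig (pos j)) z) =
      comm (pl s (y j)) (pl s (y k)).
    by apply: (sub_comm hK); apply: (sub_conj hK).
  pose E := [set q | exists i, [/\ (i < J)%N, i <> j & Us (pos k + pos i)%N q]].
  pose F := [set q | exists i, [/\ (i < J)%N, i <> k & Us (pos j + pos i)%N q]].
  apply: (@comm_isolate _ _ _ _ (Us s) E F); do ?[exact: Gpl|exact: sub_conj|exact: plf].
  - by move=> q; exact: shift_in.
  - by move=> q; rewrite /s addnC; exact: shift_in.
  - move=> q nq; apply: shift_out => i iJ iq; apply: nq.
    by case: (eqVneq i j) => [ij|/eqP ij]; [left; rewrite /s -ij|right; exists i].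
  - move=> q nq; apply: shift_out => i iJ iq; apply: nq.
    by case: (eqVneq i k) => [ik|/eqP ik]; [left; rewrite /s addnC -ik|right; exists i].
  - move=> q [i [iJ ij iq]] [l [lJ lk lq]].
    by have [[]|[]] := Us2 _ _ _ _ _ kJ jJ iJ lJ iq lq => [/esym|_ /ij].
have trK x : G x -> K (tr psi x).
  (* As [tr psi] is multiplicative, [T] is a subgroup; it contains the generating commutators, which
     come from the indices [2i] and [2i + 1]. *)
  move=> Gx; pose T := [set x | G x /\ K (tr psi x)].
  suff [] : T x by [].
  apply: (abG _ Gx); last first.
    move=> _ [i im ->]; have [Ga Gb _ _] := abP i im; split; first exact: sub_comm.
    have xa : xs i.*2 = a i by rewrite /xs odd_double doubleK ifT //; lia.
    have xb : xs i.*2.+1 = b i by rewrite /xs /= odd_double uphalf_double ifT //; lia.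
    rewrite tr_comm // -xa -xb; apply: Kcomm; rewrite /J; lia.
  apply: (homeo_subgroup_sub hG).
  - by move=> g [].
  - by split; [exact: sub1|rewrite tr1 //; exact: (sub1 hK)].
  - move=> g h [Gg Kg] [Gh Kh]; split; first exact: subM.
    by rewrite (trM _ _ ipsi); exact: (subM hK Kg Kh).
  - move=> g [Gg Kg]; split; first exact: subV.
    by rewrite (trV ipsi Gg); exact: (subV hK Kg).
have KP : contains_rist K P by apply: rist_sub Ppsi _; exact: rist_tr.
pose Ps s := [set q | exists2 t, (t <= s)%N & (sig t @` P) q].
have [cPs KPs] : (forall s, clopen (Ps s)) /\ forall s, contains_rist K (Ps s).
  have PsS s : Ps s.+1 = Ps s `|` sig s.+1 @` P.
    apply/seteqP; split=> q.
      by case=> t; rewrite leq_eqVlt => /predU1P[->|ts] tq; [right|left; exists t].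
    by case=> [[t ts tq]|sq]; [exists t => //; exact: leqW|exists s.+1].
  have Ps0 : Ps 0 = P.
    apply/seteqP; split=> q; last by move=> Pq; exists 0%N => //; exists q.
    by case=> t; rewrite leqn0 => /eqP -> [x Px <-].
  have csig s : clopen (sig s @` P) by exact: (clopen_img hG).
  have cPs s : clopen (Ps s).
    by elim: s => [|s IH]; rewrite ?Ps0 // PsS; exact: clopenU.
  split=> //; elim=> [|s IH]; first by rewrite Ps0.
  rewrite PsS; apply: rist_union => //; last exact: rist_img.
  (* Consecutive translates overlap in [f^(2s+2) B], the last level of one and the first of the
     next. *)
  exists (sig s.+1 x0); split; last by exists x0.
  exists s => //; exists (f (f x0)); last by rewrite /sig iterSr.
  by right; exists x0.
have PsT : Ps N = setT.
  apply/seteqP; split=> // q _; have [i [x [iN Bx ->]]] := fcov q.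
  exists i./2; first by lia.
  exists (iter (odd i) f x).
    by case: odd; [left; right|left; left]; exists x.
  by rewrite /sig iter_double -iterD addnC odd_double_half.
exists (f \o f), z; split => //.
- exists M => // x; rewrite iter_double -addnn iterD !fM //.
(* On each translate [Us (pos j)] the powers of [z] are the shifted powers of [y j]. *)
- have zU' j k q : (j < J)%N -> U q ->
      iter k z (sig (pos j) q) = sig (pos j) (iter k (y j) q) /\ U (iter k (y j) q).
    move=> jJ Uq; elim: k => // k [IH IHU]; rewrite !iterS IH.
    split; last exact: (fixes_stable (sub_inj hG (Gy j)) (yf j) IHU).
    by rewrite (zU j) ?plE //; exists (iter k (y j) q).
  split=> // [q|k k0 kn].
    case: (pselect (exists2 j, (j < J)%N & Us (pos j) q)) => [[j jJ [x Ux <-]]|nq].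
      by have [-> _] := zU' j n x jJ Ux; rewrite yn.
    have zq : z q = q by apply: zn => j jJ jq; apply: nq; exists j.
    by elim: (n) => //= k ->.
  (* The copy of [p0] in the piece carrying [a0], where no power below [n] returns. *)
  exists (sig (pos m.*2) (psi p0)).
  have mJ : (m.*2 < J)%N by [].
  have Up : U (psi p0) by apply: psiU; exists p0.
  have [-> _] := zU' _ k _ mJ Up; move=> /(sub_inj hG (Gsig _)).
  rewrite /y tr_iter // tr_in // /xs ltnn => /ipsi; exact: p0k.
- by apply: (rist_setT hK KG); rewrite -PsT.
Qed.

End Vigorous.

Unset Implicit Arguments.

Theorem theorem1p8 (G : set (CS -> CS)) (n : nat) :
  homeo_subgroup G -> finitely_generated G -> simple_group G -> vigorous G ->
  (2 <= n)%N ->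
  exists sigma zeta : CS -> CS,
    [/\ G sigma, G zeta, finite_order sigma, has_order zeta n &
        gen [set f | f = sigma \/ f = zeta] = G].
Proof.
by move=> hG fg sG vG n2; exact: two_generated.
Qed.
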